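(* Let $X_1,X_2,\dots$ be independent random variables with $\mathbb{E}X_i=0$ and $\mathbb{E}X_i^2=\sigma^2\in(0,\infty)$, and let $N\sim\mathrm{Geo}(p)$, $p\in(0,1)$, be independent of the $X_i$. Let $W=p^{1/2}\sum_{i=1}^NX_i$ and $Z\sim\mathrm{Laplace}(0,\sigma/\sqrt2)$. Then $$d_{\mathrm K}(W,Z)\le17.04\frac{p^{1/2}}\sigma\sup_{i\ge1}\|F_{X_i}^{-1}-F_{X_i^L}^{-1}\|.$$ If in addition $\rho=\sup_{i\ge1}\mathbb{E}|X_i|^3<\infty$, then $$d_{\mathrm W}(W,Z)\le12p^{1/2}\Big(\sigma+\frac\rho{3\sigma^2}\Big).$$ Moreover, the order $p^{1/2}$ in the Wasserstein bound cannot be improved in general: if the $X_i$ are i.i.d. with moments of all orders and $\mathbb{E}X_1^3\neq0$, then $d_{\mathrm W}(W,Z)\ge cp^{1/2}$ for some $c>0$ and all sufficiently small $p$.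
   Context: $\mathrm{Geo}(p)$ is the distribution with $\mathbb{P}(N=k)=p(1-p)^{k-1}$, $k\ge1$. For $b>0$, $\mathrm{Laplace}(0,b)$ has density $\frac1{2b}e^{-|x|/b}$. For a mean-zero random variable $X$ with finite nonzero variance, $X^L$ has the $X$-centered equilibrium distribution if $\mathbb{E}f(X)-f(0)=\frac12\mathbb{E}X^2\,\mathbb{E}f''(X^L)$ for all twice-differentiable $f$ for which the expectations exist. $F_X$ is the distribution function of $X$, $F_X^{-1}$ its generalized inverse, and $\|F_X^{-1}-F_Y^{-1}\|=\sup_{u\in(0,1)}|F_X^{-1}(u)-F_Y^{-1}(u)|$. $d_{\mathrm K}$ is the Kolmogorov distance and $d_{\mathrm W}$ the Wasserstein distance (sup over Lipschitz test functions with constant $\le1$). *)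

(* Defs.v *)
From HB Require Import structures.
From mathcomp Require Import all_boot all_order all_algebra.
From mathcomp Require Import all_classical all_reals all_analysis.
Set Implicit Arguments. Unset Strict Implicit. Unset Printing Implicit Defensive.
Import Order.TTheory GRing.Theory Num.Theory.
Import numFieldNormedType.Exports.
Local Open Scope classical_set_scope.
Local Open Scope ring_scope.

Section Defs.
Context {R : realType}.

Definition mutually_independent {d} {T : measurableType d} (P : probability T R)
  {I : eqType} (Y : I -> T -> R) : Prop :=
  forall (J : seq I) (B : I -> set R), uniq J ->
    (forall j, j \in J -> measurable (B j)) ->
    P (\bigcap_(j in [set j | j \in J]) (Y j @^-1` B j)) =
    (\prod_(j <- J) P (Y j @^-1` B j))%E.

Definition geometric_rv {d} {T : measurableType d} (P : probability T R)
  (N : T -> nat) (p : R) : Prop :=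
  (forall k, measurable (N @^-1` [set k])) /\
  (forall k, (0 < k)%N -> P (N @^-1` [set k]) = (p * (1 - p) ^+ k.-1)%:E).

(* The random sum W = p^{1/2} sum_{i=1}^N X_i  (X 0 plays the role of X_1). *)
Definition random_sum {d} {T : measurableType d} (X : nat -> T -> R)
  (N : T -> nat) (p : R) : T -> R :=
  fun w => Num.sqrt p * \sum_(i < N w) X i w.

Definition laplace_pdf (b : R) (x : R) : R := (2 * b)^-1 * expR (- (`|x| / b)).

Definition laplace_cdf (b : R) (x : R) : \bar R :=
  (\int[lebesgue_measure]_(y in `]-oo, x]) (laplace_pdf b y)%:E)%E.

Definition laplace_expect (b : R) (h : R -> R) : \bar R :=
  (\int[lebesgue_measure]_y (h y * laplace_pdf b y)%:E)%E.

Definition dK_laplace {d} {T : measurableType d} (P : probability T R)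
  (W : T -> R) (b : R) : \bar R :=
  ereal_sup (range (fun x : R => (`| P [set w | (W w <= x)%R] - laplace_cdf b x |)%E)).

Definition lipschitz1 (h : R -> R) : Prop :=
  forall x y, `|h x - h y| <= `|x - y|.

Definition dW_laplace {d} {T : measurableType d} (P : probability T R)
  (W : T -> R) (b : R) : \bar R :=
  ereal_sup [set (`| 'E_P[h \o W] - laplace_expect b h |)%E | h in lipschitz1].

Definition cdf_rv {d} {T : measurableType d} (P : probability T R)
  (X : T -> R) (x : R) : R := fine (P [set w | X w <= x]).

Definition cdf_law (L : probability R R) (x : R) : R := fine (L [set y | (y <= x)%R]).

Definition gen_inv (F : R -> R) (u : R) : R := inf [set x | u <= F x].

(* L is the law of X^L, the X-centered equilibrium distribution of X:
   E f(X) - f(0) = 1/2 E X^2 E f''(X^L) for all twice differentiable f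
   for which the expectations exist. *)
Definition equilibrium_law {d} {T : measurableType d} (P : probability T R)
  (X : T -> R) (L : probability R R) : Prop :=
  forall f : R -> R,
    (forall x, derivable f x 1) -> (forall x, derivable (derive1 f) x 1) ->
    P.-integrable setT (fun w => (f (X w))%:E) ->
    L.-integrable setT (fun x => (derive1 (derive1 f) x)%:E) ->
    ('E_P[f \o X] - (f 0)%:E =
       (2^-1)%:E * 'E_P[fun w => (X w ^+ 2)%R] * \int[L]_x (derive1 (derive1 f) x)%:E)%E.

End Defs.

(* Main.v *)
Require Import Defs.
From HB Require Import structures.
From mathcomp Require Import all_boot all_order all_algebra.
From mathcomp Require Import all_classical all_reals all_analysis.
From mathcomp Require Import measurable_realfun.
From mathcomp Require Import ring lra.
Import Order.TTheory GRing.Theory Num.Theory.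
Import numFieldNormedType.Exports.
Set Implicit Arguments.
Unset Strict Implicit.
Local Open Scope classical_set_scope.
Local Open Scope ereal_scope.
Local Open Scope ring_scope.

(** For [b = sigma / sqrt 2], the function [f x = E h(x + Z)] solves
    [f - b^2 f'' = h] with [f 0 = E h(Z)].  By memorylessness of the geometric
    law, [E f(W) - f 0] telescopes into
    [p^-1 E (f (sqrt p S_N) - f (sqrt p S_(N-1)))], where [S_n] denotes the
    partial sum of the first [n] variables, so [E h(W) - E h(Z)] reduces to one
    step of the sum, conditionally on [S_(N-1)].

    Wasserstein: the step is a Taylor expansion of [f], whose second derivative
    is [2 / b^2]-Lipschitz.

    Kolmogorov: [h] is a ramp; the equilibrium law turns the step into the
    difference of [f - h] at [X_N] and at [X_N^L], which are coupled by their
    quantiles.  The increment of the monotone [h] under a shift by [delta] is at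
    most [psi = h(. - delta) - h(. + delta)], and [psi = phi - b^2 phi''] with
    [phi = f(. - delta) - f(. + delta)] of size [delta / b], so the same
    telescoping bounds the expectation of [psi].

    Lower bound: [E sin Z = 0], while [E sin W] and [E cos W] solve a linear
    system whose coefficients are the expectations of [sin] and [cos] of
    [sqrt p X_1], and [E sin (sqrt p X_1)] is of exact order [p^(3/2)]. *)

(** * The Stein equation of the Laplace distribution *)

(** Why ramps and why [phi]: the equilibrium identity asks for a test function that is
    differentiable twice everywhere, and f'' = (f - h) / b^2 forces a continuous [h]. The quantile
    coupling then leaves the increment of [h] over an interval of length 2 [delta]. Its expectation
    is a concentration estimate for the very sum under study, and bounding it through the slope of
    the ramp would destroy the rate. The circle is broken because the equilibrium identity turns
    this term into a uniformly small part plus a signed increment of E [phi] from one partial sum to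
    the next. Summed by parts against the geometric weights, these increments total at most 2 sup
    |phi|, and the slope never enters the estimate.

    Telescoping is carried out on finite mixtures over the values of [N], so E f(W) itself is never
    formed. Since (1 - p) f + p h = f - p b^2 f'', one step is an increment of [f] with a
    second-order correction; b^2 = sigma^2 / 2 is the choice for which the two balance to leading
    order. *)

Section stein_equation.
Context {R : realType}.
Variable b : R.
Hypothesis b0 : 0 < b.
Notation mu := (@lebesgue_measure R).

Let b_neq0 : b != 0. Proof. by rewrite gt_eqF. Qed.
Let b_ge0 : 0 <= b. Proof. exact: ltW. Qed.

Lemma cvg_expR_affine (a c d : R) : 0 <= c -> 0 <= d ->
  (expR (- (t / b)) * (c + d * (t - a))) @[t --> +oo] --> (0 : R).
Proof.
move=> c0 d0.
(* By 1 + u <= exp u at u = (t - a) / (2 b), the affine factor uses up half of the decay rate; exp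
   (- t / (2 b)) remains and [M] gathers the constants. *)
pose M := (c + 2 * b * d) * expR (- (a / b)) * expR (a / (2 * b)).
have M0 : 0 <= M by rewrite !mulr_ge0 ?expR_ge0// addr_ge0// !mulr_ge0// ltW.
apply: (@squeeze_cvgr _ _ _ _ (cst 0) (fun t => M * expR (- (t / (2 * b))))).
- near=> t.
  have ta : a <= t by near: t; apply: nbhs_pinfty_ge; rewrite num_real.
  have ta0 : 0 <= t - a by rewrite subr_ge0.
  rewrite mulr_ge0 ?expR_ge0 ?addr_ge0 ?mulr_ge0//=.
  have h : c + d * (t - a) <= (c + 2 * b * d) * expR ((t - a) / (2 * b)).
    have h1 : 1 + (t - a) / (2 * b) <= expR ((t - a) / (2 * b)) by exact: expR_ge1Dx.
    have h2 : 0 <= (t - a) / (2 * b) by rewrite divr_ge0// mulr_ge0// ltW.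
    apply: (@le_trans _ _ ((c + 2 * b * d) * (1 + (t - a) / (2 * b)))); last first.
      by apply: ler_wpM2l => //; rewrite addr_ge0// !mulr_ge0// ltW.
    rewrite -subr_ge0.
    have -> : (c + 2 * b * d) * (1 + (t - a) / (2 * b)) - (c + d * (t - a)) =
        2 * b * d + c * ((t - a) / (2 * b)).
      by field.
    by rewrite addr_ge0 ?(mulr_ge0 c0 h2)// mulr_ge0// mulr_ge0.
  apply: (le_trans (ler_wpM2l (expR_ge0 _) h)).
  rewrite /M le_eqVlt; apply/orP; left; apply/eqP.
  rewrite mulrCA -!mulrA; congr (_ * _); rewrite -!expRD; congr expR; field.
  exact: b_neq0.
- exact: cvg_cst.
- rewrite -[X in _ --> X](mulr0 M); apply: cvgM; first exact: cvg_cst.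
  have -> : (fun t : R => expR (- (t / (2 * b)))) =
    (fun x => expR (- x)) \o (fun t => t * (2 * b)^-1) by [].
  apply: cvg_comp; last exact: cvgr_expR.
  by apply: gt0_cvgMly; [rewrite invr_gt0 mulr_gt0|exact: cvg_id].
Unshelve. all: by end_near. Qed.

(** Affine integrands suffice: on []-oo, x]] a [C]-Lipschitz [h] stays between h x - C (x - t) and h
    x + C (x - t), so this closed form yields both integrability and the bounds on
    [half_resolvent]. *)
Lemma integral_expR_affine (x c d : R) : 0 <= c -> 0 <= d ->
  (\int[mu]_(t in `]-oo, x]) (expR (t / b) * (c + d * (x - t)))%:E =
   (expR (x / b) * (b * c + b ^+ 2 * d))%:E)%E.
Proof.
move=> c0 d0.
pose G t := expR (t / b) * (c + d * (x - t)).
have cG : continuous G.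
  move=> t; apply: cvgM.
    apply: continuous_comp; last exact: continuous_expR.
    by apply: cvgM => //; exact: cvg_cst.
  apply: cvgD; first exact: cvg_cst.
  apply: cvgM; first exact: cvg_cst.
  by apply: cvgB => //; exact: cvg_cst.
(* Writing the end as [- - x] fits the reflection rule, which moves the integral to a half-line
   towards +oo, where the fundamental theorem of calculus is applied. *)
transitivity (\int[mu]_(t in `]-oo, (- - x)%R]) (G t)%:E)%E; first by rewrite opprK.
rewrite ge0_integration_by_substitutionNy; last 2 first.
- exact: continuous_subspaceT.
- move=> t /[!in_itv]/= tx; rewrite opprK in tx.
  by rewrite mulr_ge0 ?expR_ge0// addr_ge0// mulr_ge0// subr_ge0 ltW.
pose F t := - (expR (- (t / b)) * ((b * c + b ^+ 2 * d) + (b * d) * (t - - x))).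
have dF (t : R) : is_derive t 1 F (expR (- (t / b)) * (c + d * (x + t))).
  rewrite /F; apply: is_derive_eq.
  rewrite /= /GRing.scale/=; field. exact: b_neq0.
rewrite (@ge0_continuous_FTC2y _ _ F (- x) 0).
- by rewrite sub0e /F subrr mulr0 addr0 -EFinN mulNr !opprK.
- move=> t xt; rewrite /G /= mulr_ge0 ?expR_ge0// addr_ge0// mulr_ge0//; lra.
- apply: continuous_subspaceT => t /=.
  by apply: (continuous_comp (f := -%R) (g := G)); [exact: opp_continuous|exact: cG].
- rewrite /F -[X in _ --> X]oppr0; apply: cvgN.
  apply: cvg_expR_affine; rewrite ?addr_ge0 ?mulr_ge0//; exact: ltW.
- by move=> t _; have [] := dF t.
- apply: cvg_at_right_filter.
  have /derivable1_diffP/differentiable_continuous : derivable F (- x) 1 by have [] := dF (- x).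
  by [].
- move=> t _; rewrite derive1E; have [_ ->] := dF t.
  by rewrite /G /= opprK mulNr.
Qed.

Definition lipschitz_by (C : R) (h : R -> R) :=
  forall x y, `|h x - h y| <= C * `|x - y|.

Lemma lipschitz_by_continuous C h : lipschitz_by C h -> continuous h.
Proof.
move=> hC x; apply/cvgrPdist_lt => e e0.
have C0 : 0 < `|C| + 1 by rewrite ltr_wpDl.
near=> y.
have xy : `|x - y| < e / (`|C| + 1).
  near: y; apply: (@cvgr_dist_lt _ _ _ (nbhs x) _ id x) => //.
  by rewrite divr_gt0.
apply: (le_lt_trans (hC x y)).
move: xy; rewrite ltr_pdivlMr// => xy; apply: le_lt_trans xy.
rewrite mulrC ler_wpM2l//; have := ler_norm C; lra.
Unshelve. all: by end_near. Qed.

Lemma continuous_expR_div : continuous (fun t : R => expR (t / b)).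
Proof.
move=> t; apply: continuous_comp; last exact: continuous_expR.
by apply: cvgM => //; exact: cvg_cst.
Qed.

Lemma continuous_expRM (h : R -> R) : continuous h ->
  continuous (fun t : R => expR (t / b) * h t).
Proof. by move=> ch t; apply: cvgM; [exact: continuous_expR_div|exact: ch]. Qed.

Lemma measurable_expRM (h : R -> R) (D : set (measurableTypeR R)) : continuous h -> measurable D ->
  measurable_fun D (fun t : R => expR (t / b) * h t).
Proof.
move=> ch mD; apply/measurable_funTS.
by apply: continuous_measurable_fun; exact: continuous_expRM.
Qed.

Lemma integrable_expR_affine (x c d : R) : 0 <= c -> 0 <= d ->
  mu.-integrable `]-oo, x] (EFin \o (fun t => expR (t / b) * (c + d * (x - t)))).
Proof.
move=> c0 d0; apply/integrableP; split.
  apply/measurable_EFinP; apply: measurable_expRM => // t; apply: cvgD; first exact: cvg_cst.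
  apply: cvgM; first exact: cvg_cst.
  by apply: cvgB => //; exact: cvg_cst.
rewrite [ltLHS](_ : _ = (expR (x / b) * (b * c + b ^+ 2 * d))%:E) ?ltry//.
rewrite -integral_expR_affine//; apply: eq_integral => t; rewrite inE/= in_itv/= => tx.
by rewrite ger0_norm// mulr_ge0 ?expR_ge0// addr_ge0// mulr_ge0// subr_ge0.
Qed.

Lemma Rintegral_expR_affine (x c d : R) : 0 <= c -> 0 <= d ->
  \int[mu]_(t in `]-oo, x]) (expR (t / b) * (c + d * (x - t))) =
   expR (x / b) * (b * c + b ^+ 2 * d).
Proof. by move=> c0 d0; rewrite /Rintegral integral_expR_affine. Qed.

Lemma integrable_expRM (C : R) h (x : R) : 0 <= C -> lipschitz_by C h ->
  mu.-integrable `]-oo, x] (EFin \o (fun t => expR (t / b) * h t)).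
Proof.
move=> C0 hC; apply: le_integrable (integrable_expR_affine x (normr_ge0 (h x)) C0) => //.
  by apply/measurable_EFinP; apply: measurable_expRM => //; exact: lipschitz_by_continuous hC.
move=> t; rewrite /= in_itv/= => tx; rewrite lee_fin !normrM.
rewrite ler_wpM2l// [leRHS]ger0_norm ?addr_ge0 ?mulr_ge0 ?subr_ge0//.
have := hC t x; rewrite (ler0_norm (_ : t - x <= 0)) ?subr_le0// opprB => htx.
rewrite -[h t](subrK (h x)) (le_trans (ler_normD _ _))//; lra.
Qed.

(* Half of [E h(x - b Y)] for a standard exponential variable [Y]. *)
Definition half_resolvent (h : R -> R) (x : R) : R :=
  (2 * b)^-1 * (expR (- (x / b)) * \int[mu]_(t in `]-oo, x]) (expR (t / b) * h t)).

Lemma is_derive_half_resolvent (C : R) h (x : R) : 0 <= C -> lipschitz_by C h ->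
  is_derive x 1 (half_resolvent h) (h x / (2 * b) - half_resolvent h x / b).
Proof.
move=> C0 hC.
pose F y := \int[mu]_(t in `]-oo, y]) (expR (t / b) * h t).
have dF : is_derive x 1 F (expR (x / b) * h x).
  have [||||dF F'] := @continuous_FTC1 R (fun t => expR (t / b) * h t) -oo%O x (x + 1).
  - by rewrite ltrDl.
  - exact: integrable_expRM C0 hC.
  - by rewrite ltNyr.
  - by apply: continuous_expRM; exact: lipschitz_by_continuous hC.
  by apply: DeriveDef; [exact: dF|rewrite -derive1E; exact: F'].
rewrite /half_resolvent -/(F _).
have -> : (fun x => (2 * b)^-1 * (expR (- (x / b)) * F x)) =
   (fun x => (2 * b)^-1 * expR (- (x / b))) * F by apply/funext => y /=; rewrite mulrA.
apply: is_derive_eq.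
rewrite scaler0 add0r /GRing.scale/= mulr1.
have -> : expR (- (x / b)) = (expR (x / b))^-1 by rewrite expRN.
have e0 : expR (x / b) != 0 by rewrite gt_eqF ?expR_gt0.
by field; rewrite b_neq0 e0.
Qed.


Lemma half_resolvent_mono (C D : R) h g (x : R) : 0 <= C -> lipschitz_by C h ->
  0 <= D -> lipschitz_by D g -> (forall t, t <= x -> h t <= g t) ->
  half_resolvent h x <= half_resolvent g x.
Proof.
move=> C0 hC D0 gD hg; rewrite ler_pM2l ?invr_gt0 ?mulr_gt0//.
rewrite ler_pM2l ?expR_gt0//; apply: le_Rintegral => //.
- exact: integrable_expRM C0 hC.
- exact: integrable_expRM D0 gD.
- by move=> t; rewrite /= in_itv/= => tx; rewrite ler_pM2l ?expR_gt0// hg.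
Qed.

Lemma lipschitz_by_affine (x c d : R) :
  lipschitz_by `|d| (fun t => c + d * (x - t)).
Proof.
move=> y z; rewrite -normrM -[leRHS]normrN le_eqVlt; apply/orP; left.
by apply/eqP; congr `| _ |; ring.
Qed.

(** At x - b Y, with Y standard exponential, the affine function equals c + d b Y, and E Y = 1.
    Signs are free here, unlike in [integral_expR_affine]: the lower envelope of a Lipschitz
    function has d = -1. *)
Lemma half_resolvent_affine (x c d : R) :
  half_resolvent (fun t => c + d * (x - t)) x = 2^-1 * (c + b * d).
Proof.
rewrite /half_resolvent.
have h1 : mu.-integrable `]-oo, x] (EFin \o (fun t : R => expR (t / b) * (1 + 0 * (x - t)))).
  exact: integrable_expR_affine.
have h2 : mu.-integrable `]-oo, x] (EFin \o (fun t : R => expR (t / b) * (0 + 1 * (x - t)))).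
  exact: integrable_expR_affine.
have -> : \int[mu]_(t in `]-oo, x]) (expR (t / b) * (c + d * (x - t))) =
    c * (expR (x / b) * (b * 1 + b ^+ 2 * 0)) + d * (expR (x / b) * (b * 0 + b ^+ 2 * 1)).
  rewrite -!Rintegral_expR_affine// -!RintegralZl// -RintegralD//; last 2 first.
  - exact: (integrableZl _ c h1).
  - exact: (integrableZl _ d h2).
  by apply: eq_Rintegral => t _ /=; ring.
have -> : expR (- (x / b)) = (expR (x / b))^-1 by rewrite expRN.
have e0 : expR (x / b) != 0 by rewrite gt_eqF ?expR_gt0.
by field; rewrite b_neq0 e0.
Qed.

(** The lines of slopes 1 and -1 through the point (x, h x) enclose [h], and their values are exact.
    Subtracting [2^-1 * h x] is harmless, as it cancels between the two halves of [stein_sol']. *)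
Lemma half_resolvent_lipschitz h (x : R) : lipschitz_by 1 h ->
  `|half_resolvent h x - 2^-1 * h x| <= 2^-1 * b.
Proof.
move=> h1.
have hx t : t <= x -> h x + (- 1) * (x - t) <= h t <= h x + 1 * (x - t).
  move=> tx; have := h1 t x; rewrite mul1r (ler0_norm (_ : t - x <= 0)) ?subr_le0//.
  rewrite ler_norml; lra.
rewrite ler_norml; apply/andP; split.
- have : half_resolvent (fun t => h x + (- 1) * (x - t)) x <= half_resolvent h x.
    apply: (half_resolvent_mono _ (lipschitz_by_affine x (h x) (-1)) _ h1) => // t tx.
    by case/andP: (hx _ tx).
  rewrite half_resolvent_affine; lra.
- have : half_resolvent h x <= half_resolvent (fun t => h x + 1 * (x - t)) x.
    apply: (half_resolvent_mono _ h1 _ (lipschitz_by_affine x (h x) 1)) => // t tx.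
    by case/andP: (hx _ tx).
  rewrite half_resolvent_affine; lra.
Qed.

Lemma half_resolvent_bounded (C : R) h (x : R) : 0 <= C -> lipschitz_by C h ->
  (forall t, 0 <= h t <= 1) -> 0 <= half_resolvent h x <= 2^-1.
Proof.
move=> C0 hC h01; apply/andP; split.
- have : half_resolvent (fun t => 0 + 0 * (x - t)) x <= half_resolvent h x.
    apply: (half_resolvent_mono _ (lipschitz_by_affine x 0 0) _ hC) => // t tx.
    by rewrite mul0r addr0; case/andP: (h01 t).
  by rewrite half_resolvent_affine mulr0 addr0 mulr0.
- have : half_resolvent h x <= half_resolvent (fun t => 1 + 0 * (x - t)) x.
    apply: (half_resolvent_mono _ hC _ (lipschitz_by_affine x 1 0)) => // t tx.
    by rewrite mul0r addr0; case/andP: (h01 t).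
  by rewrite half_resolvent_affine mulr0 addr0 mulr1.
Qed.

(** This is E h(x + Z) split by the sign of the Laplace variable Z; reflecting [h] lets integrals
    over left half-lines serve both halves. *)
Definition stein_sol (h : R -> R) (x : R) : R :=
  half_resolvent h x + half_resolvent (h \o -%R) (- x).

(** Closed form of the first derivative: the terms h x / (2 b) produced by the two halves cancel. In
    the next derivative they add up, which produces the Stein equation. *)
Definition stein_sol' (h : R -> R) (x : R) : R :=
  (half_resolvent (h \o -%R) (- x) - half_resolvent h x) / b.

Lemma lipschitz_by_opp (C : R) h : lipschitz_by C h -> lipschitz_by C (h \o -%R).
Proof. by move=> hC x y; rewrite (le_trans (hC _ _))//= -opprD normrN. Qed.

Section lipschitz_stein.
Variables (C : R) (h : R -> R).
Hypotheses (C0 : 0 <= C) (hC : lipschitz_by C h).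

Let is_derive_half_resolventN (x : R) :
  is_derive x 1 (fun x => half_resolvent (h \o -%R) (- x))
    (half_resolvent (h \o -%R) (- x) / b - h x / (2 * b)).
Proof.
have := is_derive_half_resolvent (- x) C0 (lipschitz_by_opp hC).
rewrite /= opprK => H.
have H2 := is_derive1_comp H (is_deriveN (is_derive_id x (1:R))).
by apply: (is_derive_eq H2); ring.
Qed.

Lemma is_derive_stein_sol (x : R) : is_derive x 1 (stein_sol h) (stein_sol' h x).
Proof.
have H := is_deriveD (is_derive_half_resolvent x C0 hC) (is_derive_half_resolventN x).
by apply: (is_derive_eq H); rewrite /stein_sol'; ring.
Qed.

Lemma is_derive_stein_sol' (x : R) :
  is_derive x 1 (stein_sol' h) ((stein_sol h x - h x) / b ^+ 2).
Proof.
have H := is_deriveB (is_derive_half_resolventN x) (is_derive_half_resolvent x C0 hC).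
have H2 := is_deriveM H (is_derive_cst (b^-1) x 1).
apply: (is_derive_eq H2); rewrite /stein_sol /= /GRing.scale/=.
by field.
Qed.

End lipschitz_stein.

Lemma stein_sol'_lipschitz h x : lipschitz_by 1 h -> `|stein_sol' h x| <= 1.
Proof.
move=> h1; have := half_resolvent_lipschitz x h1.
have := half_resolvent_lipschitz (- x) (lipschitz_by_opp h1); rewrite /= opprK.
rewrite normrM (ger0_norm (_ : 0 <= b^-1)) ?invr_ge0// ler_pdivrMr// mul1r.
rewrite !ler_norml => /andP[a1 a2] /andP[a3 a4]; lra.
Qed.

Lemma stein_sol_bounded (C : R) h x : 0 <= C -> lipschitz_by C h ->
  (forall t, 0 <= h t <= 1) -> 0 <= stein_sol h x <= 1.
Proof.
move=> C0 hC h01.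
have := half_resolvent_bounded x C0 hC h01.
have := half_resolvent_bounded (- x) C0 (lipschitz_by_opp hC) (fun t => h01 (- t)).
rewrite /stein_sol; lra.
Qed.

(** Each half lies in [0, 1/2], so they differ by at most 1/2. The bound is free of [C], which is
    what makes steep ramps affordable. *)
Lemma stein_sol'_bounded (C : R) h x : 0 <= C -> lipschitz_by C h ->
  (forall t, 0 <= h t <= 1) -> `|stein_sol' h x| <= (2 * b)^-1.
Proof.
move=> C0 hC h01.
have := half_resolvent_bounded x C0 hC h01.
have := half_resolvent_bounded (- x) C0 (lipschitz_by_opp hC) (fun t => h01 (- t)).
rewrite normrM (ger0_norm (_ : 0 <= b^-1)) ?invr_ge0// invfM ler_pM2r ?invr_gt0//.
rewrite ler_norml; lra.
Qed.

(** The substitution rule is for nonnegative functions, so positive and negative parts are reflected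
    separately. *)
Lemma integral_oppr (f : R -> \bar R) : measurable_fun [set: R] f ->
  (\int[mu]_(r in `[0%R, +oo[) f r = \int[mu]_(r in `]-oo, 0%R]) f (- r)%R)%E.
Proof.
move=> mf; rewrite integralE [RHS]integralE; congr (_ - _)%E.
- rewrite ge0_integration_by_substitution0//; last exact: measurable_funepos.
  by apply: eq_integral => r _; rewrite !funeposE.
- rewrite ge0_integration_by_substitution0//; last exact: measurable_funeneg.
  by apply: eq_integral => r _; rewrite !funenegE.
Qed.

Lemma measurable_laplace_pdf : measurable_fun [set: R] (laplace_pdf b).
Proof.
apply: continuous_measurable_fun => x; apply: cvgM; first exact: cvg_cst.
apply: (@continuous_comp _ _ _ (fun y : R => - (`|y| / b)) expR x); last exact: continuous_expR.
apply: cvgN; apply: cvgM; last exact: cvg_cst.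
exact: norm_continuous.
Qed.

Lemma integral_half_laplace (C : R) h : 0 <= C -> lipschitz_by C h ->
  (\int[mu]_(y in `]-oo, 0%R]) (h y * laplace_pdf b y)%:E = (half_resolvent h 0)%:E)%E.
Proof.
move=> C0 hC.
have ih := integrable_expRM 0 C0 hC.
rewrite /half_resolvent mul0r oppr0 expR0 mul1r -RintegralZl// /Rintegral fineK.
  apply: eq_integral => y; rewrite inE/= in_itv/= => y0.
  by rewrite /laplace_pdf ler0_norm// mulNr opprK mulrC mulrA.
by apply: integrable_fin_num => //; exact: (integrableZl _ _ ih).
Qed.

Lemma laplace_expect_stein_sol (C : R) h : 0 <= C -> lipschitz_by C h ->
  laplace_expect b h = (stein_sol h 0)%:E.
Proof.
move=> C0 hC; rewrite /laplace_expect.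
have mh : measurable_fun [set: R] (fun y => (h y * laplace_pdf b y)%:E).
  apply/measurable_EFinP/measurable_funM; last exact: measurable_laplace_pdf.
  by apply: continuous_measurable_fun; exact: lipschitz_by_continuous hC.
have -> : [set: R] = `]-oo, 0%R] `|` `]0%R, +oo[.
  by apply/esym/seteqP; split => // y _ /=; rewrite !in_itv/= andbT; case: leP; [left|right].
rewrite integral_setU//; last 2 first.
- exact: measurable_funTS.
- apply/disj_setPS => y /=; rewrite !in_itv/= andbT => -[]; lra.
rewrite integral_itv_obnd_cbnd; last exact: measurable_funTS.
rewrite integral_oppr// /stein_sol EFinD oppr0; congr (_ + _)%E.
  exact: integral_half_laplace C0 hC.
rewrite -(integral_half_laplace C0 (lipschitz_by_opp hC)).
by apply: eq_integral => y _; rewrite /laplace_pdf normrN.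
Qed.

End stein_equation.

(** * Partial sums of independent variables and geometric mixtures *)

Section independent_pair.
Context d (T : measurableType d) (R : realType) (P : probability T R).
Local Open Scope ereal_scope.

Definition rv_pair (S Z : {RV P >-> R}) (w : T) : R * R := (S w, Z w).

Lemma measurable_rv_pair S Z : measurable_fun [set: T] (rv_pair S Z).
Proof. exact: measurable_fun_pair. Qed.

HB.instance Definition _ S Z :=
  @isMeasurableFun.Build _ _ _ _ (rv_pair S Z) (measurable_rv_pair S Z).

Definition indep_pair (S Z : T -> R) := forall A1 A2, measurable A1 -> measurable A2 ->
  P (S @^-1` A1 `&` Z @^-1` A2) = P (S @^-1` A1) * P (Z @^-1` A2).

Lemma indep_pair_law (S Z : {RV P >-> R}) (D : set (R * R)) : indep_pair S Z ->
  measurable D -> (distribution P S \x distribution P Z) D = distribution P (rv_pair S Z) D.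
Proof. by move=> SZ mD; apply: product_measure_unique => // A1 A2; exact: SZ. Qed.

(** Stands in for conditioning on [S]: the inner integral runs over a second copy [v] of the sample
    space while [S w] is frozen. Fubini is applied to the product of the two laws; integrability at
    every [s], not just almost every one, identifies the inner integral everywhere. *)
Lemma Rintegral_indep (S Z : {RV P >-> R}) (F : R * R -> R) : indep_pair S Z ->
  measurable_fun [set: R * R] F ->
  P.-integrable [set: T] (fun w => (F (S w, Z w))%:E) ->
  (forall s, P.-integrable [set: T] (fun v => (F (s, Z v))%:E)) ->
  P.-integrable [set: T] (fun w => (\int[P]_v F (S w, Z v))%R%:E) /\
  (\int[P]_w F (S w, Z w) = \int[P]_w \int[P]_v F (S w, Z v))%R.
Proof.
move=> SZ mF iSZ iZ.
pose nu : probability R R := distribution P S.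
pose mx : probability R R := distribution P Z.
have mEF : measurable_fun [set: R * R] (EFin \o F) by exact/measurable_EFinP.
have iF : (nu \x mx)%E.-integrable [set: R * R] (EFin \o F).
  apply/integrableP; split => //.
  rewrite (@eq_measure_integral _ _ _ _ (distribution P (rv_pair S Z))); last first.
    by move=> A mA _; exact: indep_pair_law.
  rewrite ge0_integral_distribution//; last exact: measurableT_comp.
  by have /integrableP[] := iSZ.
have EG : fubini_F mx (EFin \o F) = (fun s => (\int[P]_v F (s, Z v))%R%:E).
  apply/funext => s; rewrite /fubini_F /mx integral_distribution//.
  - by rewrite /Rintegral fineK//; exact: integrable_fin_num.
  - exact: measurableT_comp.
  - exact: iZ.
have iG := integrable_fubini_F iF; rewrite EG in iG.
have mG := measurable_int nu iG.
have iGP : P.-integrable [set: T] (fun w => (\int[P]_v F (S w, Z v))%R%:E).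
  apply/integrableP; split; first exact: (measurableT_comp mG).
  have /integrableP[_] := iG.
  by rewrite ge0_integral_distribution//; exact: measurableT_comp.
split => //.
rewrite /Rintegral; congr fine.
transitivity (\int[nu \x mx]_z (EFin \o F) z).
  rewrite (@eq_measure_integral _ _ _ _ (distribution P (rv_pair S Z))); last first.
    by move=> A mA _; exact: indep_pair_law.
  by rewrite integral_distribution.
rewrite -integral12_prod_meas1// -/(fubini_F mx (EFin \o F)) EG.
by rewrite integral_distribution.
Qed.

End independent_pair.

(** * Partial sums: independence, one-step recursion, geometric mixing *)

Section partial_sums.
Context d (T : measurableType d) (R : realType) (P : probability T R).
Variable X : nat -> {RV P >-> R}.

Definition psum (n : nat) (w : T) : R := \sum_(i < n) X i w.

Lemma measurable_psum n : measurable_fun [set: T] (psum n).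
Proof. by apply: measurable_sum => i. Qed.

HB.instance Definition _ n := @isMeasurableFun.Build _ _ _ _ (psum n) (measurable_psum n).

Lemma psumS n w : psum n.+1 w = psum n w + X n w.
Proof. by rewrite /psum big_ord_recr. Qed.

Section independence.
Variable N : T -> nat.
Let Y (o : option nat) : T -> R :=
  match o with None => fun w => (N w)%:R | Some i => X i end.
Hypothesis mN : forall k, measurable (N @^-1` [set k]).
Hypothesis indY : mutually_independent P Y.

Lemma measurable_fun_natr : measurable_fun [set: T] (fun w => (N w)%:R : R).
Proof.
move=> _ A mA; rewrite setTI.
rewrite (_ : _ @^-1` A = \bigcup_(k in [set k : nat | A k%:R]) (N @^-1` [set k])).
  by apply: bigcup_measurable => k _; exact: mN.
by apply/seteqP; split => [w Aw|w [k Ak /= Nk]]; [exists (N w)|rewrite /preimage/= Nk].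
Qed.

Let mY o : measurable_fun [set: T] (Y o).
Proof. by case: o => [i|]//; exact: measurable_fun_natr. Qed.

Let event (J : seq (option nat)) (B : option nat -> set R) :=
  \bigcap_(j in [set j | j \in J]) (Y j @^-1` B j).

Let measurable_event J B : (forall j, j \in J -> measurable (B j)) -> measurable (event J B).
Proof.
move=> mB; apply: fin_bigcap_measurable => [|j jJ]; first exact: finite_seq.
by rewrite -[X in measurable X]setTI; apply: mY => //; exact: mB.
Qed.

Let event_cons j J B : event (j :: J) B = (Y j @^-1` B j) `&` event J B.
Proof.
apply/seteqP; split => w.
  move=> h; split; first by apply: h; rewrite /= mem_head.
  by move=> k kJ; apply: h; rewrite /= inE kJ orbT.
move=> [h1 h2] k /=; rewrite inE => /orP[/eqP ->//|]; exact: h2.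
Qed.

Local Open Scope ereal_scope.

(* On the next step, the pair of [psum n] and [X n] has the product law both
   under [P] and conditionally on [event J B]: both laws agree on rectangles. *)
Lemma psum_indep n (A : set R) J B : measurable A -> uniq J ->
    (forall j, j \in J -> measurable (B j)) ->
    (forall i, (i < n)%N -> Some i \notin J) ->
  P (psum n @^-1` A `&` event J B) = P (psum n @^-1` A) * \prod_(j <- J) P (Y j @^-1` B j).
Proof.
elim: n A J B => [|n IH] A J B mA uJ mB nJ.
  have [A0|A0] := pselect (A 0%R).
  - have -> : psum 0 @^-1` A = setT.
      by apply/seteqP; split => // w _; rewrite /preimage/= /psum big_ord0.
    by rewrite setTI probability_setT mul1e indY.
  - have -> : psum 0 @^-1` A = set0.
      by apply/seteqP; split => // w; rewrite /preimage/= /psum big_ord0.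
    by rewrite set0I measure0 mul0e.
have mE := measurable_event mB.
pose c := \prod_(j <- J) P (Y j @^-1` B j).
have c0 : 0 <= c by rewrite /c; elim/big_ind : _ => //; exact: mule_ge0.
have PE : P (event J B) = c by rewrite indY.
have cfin : c \is a fin_num by rewrite -PE fin_num_measure.
pose D := [set z : R * R | A (z.1 + z.2)%R].
have mD : measurable D.
  rewrite -[D]setTI; apply: (measurable_funD measurable_fst measurable_snd) => //.
have DE w : psum n.+1 w = ((rv_pair (psum n) (X n) w).1 + (rv_pair (psum n) (X n) w).2)%R.
  by rewrite psumS.
have preD : psum n.+1 @^-1` A = rv_pair (psum n) (X n) @^-1` D.
  by apply/seteqP; split => w; rewrite /preimage/= DE.
(* A null event is set apart, because conditioning on the event divides by [c]. *)
have [c00|cn0] := eqVneq c 0.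
  rewrite -/c c00 mule0; apply/eqP; rewrite eq_le measure_ge0 andbT -c00 -PE.
  by apply: le_measure; rewrite ?inE//; apply: measurableI => //;
    rewrite -[X in measurable X]setTI; exact: measurable_psum.
have rc0 : (0 < fine c)%R by rewrite fine_gt0// lt0e cn0 c0/= -ge0_fin_numE.
have rci0 : (0 <= (fine c)^-1)%R by rewrite invr_ge0 ltW.
have cV : (fine c)^-1%:E * c = 1.
  by rewrite -[X in _ * X](fineK cfin) -EFinM mulVf// gt_eqF.
(* The conditional law of the pair: restrict [P] to the event, push forward, divide by [c]. The set
   [D] describing the sum is not a rectangle, hence the detour through uniqueness of the product
   measure. *)
pose m1f := mscale (NngNum rci0) (pushforward (mrestr P mE) (rv_pair (psum n) (X n))).
pose m1 := m1f (measurable_rv_pair (psum n) (X n)).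
pose m0 := distribution P (rv_pair (psum n) (X n)).
pose nu := distribution P (psum n).
pose mx := distribution P (X n).
have E0 : (nu \x mx) D = m0 D.
  apply: product_measure_unique => // A1 A2 mA1 mA2.
  rewrite /m0 /nu /mx /distribution /pushforward.
  have := IH A1 [:: Some n] (fun=> A2) mA1 erefl (fun _ _ => mA2).
  rewrite event_cons /event big_seq1 => <-.
    congr (P _); apply/seteqP; split => w.
      by move=> [h1 h2]; split => //; split.
    by move=> [h1 [h2 _]]; split.
  by move=> i ni; rewrite inE; apply/eqP => -[] ii; rewrite ii ltnn in ni.
have E1 : (nu \x mx) D = m1 D.
  apply: product_measure_unique => // A1 A2 mA1 mA2.
  change ((fine c)^-1%:E * P (rv_pair (psum n) (X n) @^-1` (A1 `*` A2) `&` event J B) =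
    P (psum n @^-1` A1) * P (X n @^-1` A2)).
  have nJ' : Some n \notin J by exact: nJ.
  (* [B'] puts [A2] at the new index and keeps [B] on [J], so the induction hypothesis applies to
     [Some n :: J]. *)
  pose B' j := if j == Some n then A2 else B j.
  have BB' j : j \in J -> B' j = B j.
    by rewrite /B'; case: eqP => // -> jJ; rewrite jJ in nJ'.
  have := IH A1 (Some n :: J) B' mA1.
  rewrite /= nJ' uJ => /(_ erefl).
  have B'n : B' (Some n) = A2 by rewrite /B' eqxx.
  rewrite event_cons big_cons [Y (Some n)]/= B'n.
  have -> : event J B' = event J B by apply: eq_bigcapr => j /= jJ; rewrite BB'.
  have -> : \prod_(j <- J) P (Y j @^-1` B' j) = c.
    by rewrite /c big_seq [in RHS]big_seq; apply: eq_bigr => j jJ; rewrite BB'.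
  move=> IHc.
  have -> : rv_pair (psum n) (X n) @^-1` (A1 `*` A2) `&` event J B =
      psum n @^-1` A1 `&` (X n @^-1` A2 `&` event J B).
    by apply/seteqP; split => w; [move=> [[h1 h2] h3]|move=> [h1 [h2 h3]]].
  rewrite IHc; last 2 first.
  - by move=> j; rewrite inE /B'; case: eqP => [//|_] /=; exact: mB.
  - move=> i ni; rewrite inE negb_or nJ ?(ltn_trans ni)// andbT.
    by apply/eqP => -[] ii; rewrite ii ltnn in ni.
  by rewrite (muleA (P _)) (muleC _ c) muleA cV mul1e.
have E2 : P (rv_pair (psum n) (X n) @^-1` D `&` event J B) = c * m0 D.
  rewrite -E0 E1.
  change (P (rv_pair (psum n) (X n) @^-1` D `&` event J B) =
    c * ((fine c)^-1%:E * P (rv_pair (psum n) (X n) @^-1` D `&` event J B))).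
  by rewrite muleA (muleC c) cV mul1e.
by rewrite preD E2 -/c muleC.
Qed.

Lemma psum_indepX n : indep_pair P (psum n) (X n).
Proof.
move=> A1 A2 mA1 mA2.
have := psum_indep (n := n) (J := [:: Some n]) (B := fun=> A2) mA1 erefl (fun _ _ => mA2).
rewrite event_cons /event big_seq1 => <-.
  congr (P _); apply/seteqP; split => w.
    by move=> [h1 h2]; split => //; split.
  by move=> [h1 [h2 _]]; split.
by move=> i ni; rewrite inE; apply/eqP => -[] ii; rewrite ii ltnn in ni.
Qed.

Lemma psum_indepN n : indep_pair P (psum n) (fun w => (N w)%:R).
Proof.
move=> A1 A2 mA1 mA2.
have := psum_indep (n := n) (J := [:: None]) (B := fun=> A2) mA1 erefl (fun _ _ => mA2).
rewrite event_cons /event big_seq1 => <- //.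
congr (P _); apply/seteqP; split => w.
  by move=> [h1 h2]; split => //; split.
by move=> [h1 [h2 _]]; split.
Qed.

End independence.

Section expectations.
Variable N : T -> nat.
Let Y (o : option nat) : T -> R :=
  match o with None => fun w => (N w)%:R | Some i => X i end.
Hypothesis mN : forall k, measurable (N @^-1` [set k]).
Hypothesis indY : mutually_independent P Y.
Hypothesis iX : forall i, P.-integrable [set: T] (EFin \o X i).

(** A single class for Lipschitz and bounded test functions; its measurable members have finite
    expectation at every integrable variable. *)
Definition linear_growth (g : R -> R) :=
  exists K, forall x, `|g x| <= K * (1 + `|x|).

Lemma integrable_linear_growth (Z : T -> R) (g : R -> R) : measurable_fun [set: R] g ->
  linear_growth g -> P.-integrable [set: T] (EFin \o Z) ->
  P.-integrable [set: T] (EFin \o (g \o Z)).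
Proof.
move=> mg [K gK] iZ.
have mZ : measurable_fun [set: T] Z by apply/measurable_EFinP; exact: measurable_int iZ.
have i1 : P.-integrable [set: T] (EFin \o (fun w => K * (1 + `|Z w|))).
  have i2 : P.-integrable [set: T] (EFin \o (fun w => 1 + `|Z w|)).
    exact: (integrableD measurableT (finite_measure_integrable_cst P 1 measurableT)
      (integrable_abse iZ)).
  exact: (integrableZl _ K i2).
apply: le_integrable i1 => //.
  by apply/measurable_EFinP/measurableT_comp.
by move=> w _ /=; rewrite lee_fin (le_trans (gK _))// ler_norm.
Qed.

Lemma integrable_psum n : P.-integrable [set: T] (EFin \o psum n).
Proof.
rewrite (_ : EFin \o psum n = fun w => (\sum_(i < n) (X i w)%:E)%E).
  by apply: integrable_sum => // i _; exact: iX.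
by apply/funext => w; rewrite /psum /= sumEFin.
Qed.

Lemma integrable_addr (c : R) (Z : T -> R) : P.-integrable [set: T] (EFin \o Z) ->
  P.-integrable [set: T] (EFin \o (fun w => c + Z w)).
Proof.
move=> iZ.
have := integrableD measurableT (finite_measure_integrable_cst P c measurableT) iZ.
exact.
Qed.

Lemma Rintegral_psumS n (g : R -> R) : measurable_fun [set: R] g -> linear_growth g ->
  P.-integrable [set: T] (fun w => (\int[P]_v g (psum n w + X n v))%:E) /\
  \int[P]_w g (psum n.+1 w) = \int[P]_w \int[P]_v g (psum n w + X n v).
Proof.
move=> mg lg.
have [] := Rintegral_indep (F := fun z => g (z.1 + z.2)) (@psum_indepX N mN indY n).
- apply: (measurableT_comp mg).
  exact: (measurable_funD measurable_fst measurable_snd).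
- have := integrable_linear_growth mg lg (integrable_psum n.+1).
  by congr (_.-integrable _ _); apply/funext => w; rewrite /= psumS.
- by move=> s; exact: (integrable_linear_growth mg lg (integrable_addr s (iX n))).
move=> i1 e; split; first exact: i1.
by rewrite -e; apply: eq_Rintegral => w _; rewrite psumS.
Qed.

(** Independence of [N] and the sum of fixed length, applied to [g] times an indicator. The event {N
    = k} is read on [(N w)%:R], since the independent family is real-valued. *)
Lemma Rintegral_psumN n k (g : R -> R) : measurable_fun [set: R] g -> linear_growth g ->
  \int[P]_(w in N @^-1` [set k]) g (psum n w) =
  fine (P (N @^-1` [set k])) * \int[P]_w g (psum n w).
Proof.
move=> mg lg.
have ig := integrable_linear_growth mg lg (integrable_psum n).
pose F (z : R * R) := g z.1 * \1_[set k%:R] z.2.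
have mF : measurable_fun [set: R * R] F.
  apply: measurable_funM; first exact: (measurableT_comp mg).
  by apply: measurableT_comp => //; exact: measurable_indic.
have iB (h : T -> R) (D : set T) : measurable D ->
    P.-integrable [set: T] (EFin \o h) -> P.-integrable [set: T] (fun w => (h w * \1_D w)%:E).
  move=> mD ih; apply: (le_integrable _ _ _ ih) => //.
    apply/measurable_EFinP/measurable_funM; last exact: measurable_indic.
    by apply/measurable_EFinP; exact: measurable_int ih.
  move=> w _ /=; rewrite lee_fin normrM ler_piMr// indicE normr_nat; by case: (_ \in _).
have indE w : \1_[set k%:R] ((N w)%:R : R) = \1_(N @^-1` [set k]) w :> R.
  rewrite !indicE; congr (_%:R); congr nat_of_bool; apply/idP/idP; rewrite !inE/=.
    by move/eqP; rewrite eqr_nat => /eqP.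
  by move=> ->.
pose Zm := isMeasurableFun.Build _ _ _ _ _ (measurable_fun_natr mN).
pose Z : {RV P >-> R} := MeasurableFun.Pack (MeasurableFun.Class Zm).
have [||_] := Rintegral_indep (Z := Z) (@psum_indepN N mN indY n) mF.
- have := iB _ _ (mN k) ig.
  by congr (_.-integrable _ _); apply/funext => w; rewrite /F/= indE.
- move=> s; have := iB _ _ (mN k) (finite_measure_integrable_cst P (g s) measurableT).
  by congr (_.-integrable _ _); apply/funext => w; rewrite /F/= indE.
have -> : \int[P]_w F (psum n w, Z w) = \int[P]_(w in N @^-1` [set k]) g (psum n w).
  rewrite [RHS]Rintegral_mkcond; apply: eq_Rintegral => w _.
  by rewrite /F /= indE patchE indicE; case: ifPn; rewrite ?mulr1 ?mulr0.
move=> ->; rewrite -RintegralZl//; apply: eq_Rintegral => w _.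
rewrite /F/=; under eq_Rintegral do rewrite indE.
rewrite RintegralZl//; last first.
  exact: (integrable_indic _ (mN k)).
by rewrite mulrC /Rintegral integral_indic// setIT.
Qed.

Definition rsum (w : T) : R := psum (N w) w.

Lemma rsum_eq k w : N w = k -> rsum w = psum k w.
Proof. by rewrite /rsum => ->. Qed.

Lemma bigcup_preimageN : \bigcup_k (N @^-1` [set k]) = [set: T].
Proof. by apply/seteqP; split => // w _; exists (N w). Qed.

Lemma trivIset_preimageN : trivIset setT (fun k => N @^-1` [set k]).
Proof.
apply/trivIsetP => i j _ _ ij; apply/seteqP; split => // w [/= -> /eqP].
by rewrite (negbTE ij).
Qed.

Lemma measurable_rsum : measurable_fun [set: T] rsum.
Proof.
move=> _ A mA; rewrite setTI.
rewrite (_ : rsum @^-1` A = \bigcup_k (psum k @^-1` A `&` N @^-1` [set k])).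
  apply: bigcup_measurable => k _; apply: measurableI => //.
  by rewrite -[X in measurable X]setTI; exact: measurable_psum.
apply/seteqP; split => w.
  by move=> Aw; exists (N w).
by move=> [k _ [Ak /= /rsum_eq ->]].
Qed.

(** * The geometric law of [N] *)

Variable p : R.
Hypothesis p01 : 0 < p < 1.
Hypothesis geoN : forall k, (0 < k)%N -> P (N @^-1` [set k]) = (p * (1 - p) ^+ k.-1)%:E.

Let p0 : 0 < p. Proof. by case/andP: p01. Qed.
Let p1 : p < 1. Proof. by case/andP: p01. Qed.
Let q0 : 0 < 1 - p. Proof. by rewrite subr_gt0. Qed.

Let cvg_q : ((1 - p) ^+ n : R) @[n --> \oo] --> (0 : R).
Proof. by apply: cvg_expr; rewrite ger0_norm ?ltW// ltrBlDr ltrDl. Qed.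

Lemma preimageN_lt n : [set w | (N w < n.+1)%N] = [set w | (N w < n)%N] `|` N @^-1` [set n].
Proof.
apply/seteqP; split => w /=.
  by rewrite ltnS leq_eqVlt => /orP[/eqP|]; [right|left].
by case=> [h|->//]; rewrite ltnS ltnW.
Qed.

Lemma measurable_Nlt n : measurable [set w | (N w < n)%N].
Proof.
elim: n => [|n IH]; first by rewrite (_ : [set _ | _] = set0)//; apply/seteqP; split.
by rewrite preimageN_lt; apply: measurableU.
Qed.

Lemma disjoint_Nlt n : [disjoint [set w | (N w < n)%N] & N @^-1` [set n]].
Proof. by apply/disj_setPS => w [/= + wn]; rewrite wn ltnn. Qed.

(** [geometric_rv] prescribes the masses at k >= 1 only. The first n of them leave at most (1 - p)^n
    for the value 0, and n is arbitrary. *)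
Lemma probN0 : P (N @^-1` [set 0%N]) = 0%E.
Proof.
have PN n : P [set w | (N w < n.+1)%N] = (P (N @^-1` [set 0%N]) + (1 - (1 - p) ^+ n)%:E)%E.
  elim: n => [|n IH].
    rewrite expr0 subrr adde0; congr (P _).
    by apply/seteqP; split => w /=; rewrite ltnS leqn0 => /eqP.
  rewrite preimageN_lt.
  have -> : P ([set w | (N w < n.+1)%N] `|` N @^-1` [set n.+1]) =
      (P [set w | (N w < n.+1)%N] + P (N @^-1` [set n.+1]))%E.
    apply: measureU => //; first exact: measurable_Nlt.
    exact/disj_set2P/disjoint_Nlt.
  by rewrite IH (geoN (ltn0Sn n)) -addeA -EFinD /=; congr (_ + _%:E)%E; rewrite exprS; ring.
have h n : fine (P (N @^-1` [set 0%N])) <= (1 - p) ^+ n.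
  have : (P [set w | (N w < n.+1)%N] <= 1)%E by apply: probability_le1; exact: measurable_Nlt.
  have f0 : P (N @^-1` [set 0%N]) \is a fin_num by rewrite fin_num_measure.
  by rewrite PN -(fineK f0) -EFinD lee_fin; lra.
have /le_anti : (fine (P (N @^-1` [set 0%N])) <= 0) && (0 <= fine (P (N @^-1` [set 0%N]))).
  rewrite fine_ge0 ?measure_ge0// andbT.
  apply: (ler_cvg_to (cvg_cst (fine (P (N @^-1` [set 0%N])))) cvg_q).
  exact: nearW.
by move=> f0; rewrite -[LHS]fineK ?f0// fin_num_measure.
Qed.

Lemma Rintegral_rsum_lt n (g : R -> R) : measurable_fun [set: R] g -> linear_growth g ->
  P.-integrable [set: T] (EFin \o (g \o rsum)) ->
  \int[P]_(w in [set w | (N w < n.+1)%N]) g (rsum w) =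
  \sum_(j < n) p * (1 - p) ^+ j * \int[P]_w g (psum j.+1 w).
Proof.
move=> mg lg ig.
have e k : \int[P]_(w in N @^-1` [set k]) g (rsum w) =
    fine (P (N @^-1` [set k])) * \int[P]_w g (psum k w).
  rewrite -Rintegral_psumN//; apply: eq_Rintegral => w; rewrite inE => /= /rsum_eq -> //.
elim: n => [|n IH].
  rewrite big_ord0 (_ : [set _ | _] = N @^-1` [set 0%N]) ?e ?probN0 ?mul0r//.
  by apply/seteqP; split => w /=; rewrite ltnS leqn0 => /eqP.
rewrite preimageN_lt Rintegral_setU//; last 3 first.
- exact: measurable_Nlt.
- by apply: integrableS ig => //; apply: measurableU => //; exact: measurable_Nlt.
- exact: disjoint_Nlt.
by rewrite IH e (geoN (ltn0Sn n)) big_ord_recr.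
Qed.

(** Dominated convergence along the truncations to {N < n + 1}. Expectations of the random sum are
    handled from here on as limits of finite mixtures, with index j standing for N = j + 1. *)
Lemma cvg_geometric_mixture (g : R -> R) : measurable_fun [set: R] g -> linear_growth g ->
  P.-integrable [set: T] (EFin \o (g \o rsum)) ->
  (\sum_(j < n) p * (1 - p) ^+ j * \int[P]_w g (psum j.+1 w)) @[n --> \oo] -->
  \int[P]_w g (rsum w).
Proof.
move=> mg lg ig.
under eq_fun do rewrite -Rintegral_rsum_lt//.
pose f_ n w := ((g \o rsum) \_ [set w | (N w < n.+1)%N] w)%:E.
have mgr : measurable_fun [set: T] (g \o rsum) by exact: measurableT_comp measurable_rsum.
have mf_ n : measurable_fun [set: T] (f_ n).
  apply/measurable_EFinP; apply/(measurable_restrictT _ (measurable_Nlt n.+1)).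
  exact: measurable_funTS.
have [||||_ _ cv] := @dominated_convergence _ T R P setT measurableT f_
    (fun w => (g (rsum w))%:E) (fun w => `|(g (rsum w))%:E|%E) mf_.
- exact/measurable_EFinP.
- apply: aeW => w _; apply: cvg_near_cst; near=> n.
  rewrite /f_ patchE mem_set//=.
  by rewrite ltnS; near: n; exact: nbhs_infty_ge.
- exact: integrable_abse.
- apply: aeW => w n _; rewrite /f_ patchE; case: ifPn => //.
  by rewrite abse0.
apply: fine_cvg.
rewrite fineK; last exact: integrable_fin_num.
move: cv; apply: cvg_trans; apply: near_eq_cvg; apply: nearW => n /=.
by rewrite [RHS]integral_mkcond; apply: eq_integral => w _; rewrite /f_ !patchE; case: ifPn.
Unshelve. all: by end_near. Qed.

(** Truncated form of E N = 1 / p. It serves the integrability of the random sum and, later, the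
    limit of n q^n. *)
Lemma sum_geometricM n :
  \sum_(j < n) p * (1 - p) ^+ j * j.+1%:R = (1 - (1 - p) ^+ n) / p - n%:R * (1 - p) ^+ n.
Proof.
have pn0 : p != 0 by rewrite gt_eqF.
elim: n => [|n IH]; first by rewrite big_ord0 expr0 subrr !mul0r subrr.
rewrite big_ord_recr/= IH !exprS -natr1; field; exact: pn0.
Qed.

Lemma sum_geometric n : \sum_(j < n) p * (1 - p) ^+ j = 1 - (1 - p) ^+ n.
Proof.
elim: n => [|n IH]; first by rewrite big_ord0 expr0 subrr.
by rewrite big_ord_recr/= IH exprS; ring.
Qed.

Lemma Rintegral_norm_psum_le (M : R) n : (forall i, \int[P]_w `|X i w| <= M) ->
  \int[P]_w `|psum n w| <= n%:R * M.
Proof.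
move=> XM; elim: n => [|n IH].
  rewrite mul0r; under eq_Rintegral do rewrite /psum big_ord0 normr0.
  by rewrite Rintegral_cst// mul0r.
have i1 := integrable_abse (integrable_psum n).
have i2 := integrable_abse (iX n).
apply: (@le_trans _ _ (\int[P]_w (`|psum n w| + `|X n w|))).
  apply: le_Rintegral => //.
  - exact: (integrable_abse (integrable_psum n.+1)).
  - exact: (integrableD _ i1 i2).
  - by move=> w _; rewrite psumS ler_normD.
by rewrite RintegralD// -natr1 mulrDl mul1r lerD.
Qed.

Lemma integrable_rsum (M : R) : (forall i, \int[P]_w `|X i w| <= M) ->
  P.-integrable [set: T] (EFin \o rsum).
Proof.
move=> XM.
have M0 : 0 <= M by apply: le_trans (XM 0%N); exact: Rintegral_ge0.
have ma : measurable_fun [set: R] (fun x : R => `|x|) by exact: normr_measurable.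
have la : linear_growth (fun x : R => `|x|).
  by exists 1 => x; rewrite mul1r normr_id lerDr.
apply/integrableP; split; first exact/measurable_EFinP/measurable_rsum.
rewrite -bigcup_preimageN ge0_integral_bigcup//; last 2 first.
- rewrite bigcup_preimageN.
  by apply/measurable_EFinP; apply: measurableT_comp => //; exact: measurable_rsum.
- exact: trivIset_preimageN.
have e k : (\int[P]_(w in N @^-1` [set k]) `|(EFin \o rsum) w| =
    (fine (P (N @^-1` [set k])) * \int[P]_w `|psum k w|)%:E)%E.
  rewrite -Rintegral_psumN// /Rintegral fineK.
    by apply: eq_integral => w; rewrite inE => /= /rsum_eq ->.
  apply: integrable_fin_num => //.
  by apply: (integrableS measurableT) => //; exact: (integrable_abse (integrable_psum k)).
(* [M / p] is [M] times the mean of [N]. *)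
apply: (@le_lt_trans _ _ (M / p)%:E); last by rewrite ltry.
apply: lime_le; first by apply: is_cvg_nneseries => k _ _; exact: integral_ge0.
apply: nearW => -[|n].
  by rewrite big_geq// lee_fin divr_ge0// ltW.
under eq_bigr do rewrite e.
rewrite sumEFin lee_fin big_nat_recl//= probN0 mul0r add0r big_mkord.
apply: (@le_trans _ _ (\sum_(j < n) p * (1 - p) ^+ j * j.+1%:R * M)).
  apply: ler_sum => j _; rewrite (geoN (ltn0Sn j))/= -[leRHS]mulrA.
  rewrite ler_wpM2l ?mulr_ge0 ?exprn_ge0 ?(ltW p0) ?(ltW q0)//.
  exact: Rintegral_norm_psum_le.
rewrite -mulr_suml sum_geometricM mulrC ler_wpM2l//.
rewrite mulrBl mul1r -addrA gerDl subr_le0.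
by rewrite (@le_trans _ _ 0) ?oppr_le0 ?mulr_ge0 ?invr_ge0 ?exprn_ge0 ?(ltW p0) ?(ltW q0).
Qed.

End expectations.

End partial_sums.

(** * Quantile coupling *)

Lemma integrable_bounded d (T : measurableType d) (R : realType) (P : probability T R)
    (f : T -> R) (M : R) : measurable_fun [set: T] f -> (forall x, `|f x| <= M) ->
  P.-integrable [set: T] (EFin \o f).
Proof.
move=> mf fM; apply: measurable_bounded_integrable => //.
- by rewrite (le_lt_trans (probability_le1 _ _))// ltry.
- exists M; split; first exact: num_real.
  by move=> x Mx y _ /=; rewrite (le_trans (fM _))// ltW.
Qed.

Section quantile.
Context d (T : measurableType d) (R : realType) (P : probability T R).
Variable X : {RV P >-> R}.
Notation mu := (@lebesgue_measure R).

Let F := cdf_rv P X.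

Let cdfE x : F x = fine (cdf X x).
Proof. by rewrite /F /cdf_rv /cdf /distribution /pushforward; congr (fine (P _)). Qed.

Let F_nd x y : x <= y -> F x <= F y.
Proof.
by move=> xy; rewrite !cdfE fine_le ?fin_num_measure//; exact: cdf_nondecreasing.
Qed.

Lemma cdf_rv_ge0 x : 0 <= F x. Proof. by rewrite cdfE fine_ge0. Qed.

Lemma cdf_rv_le1 x : F x <= 1.
Proof. by rewrite cdfE -lee_fin fineK ?fin_num_measure//; exact: cdf_le1. Qed.

Let F_y : F x @[x --> +oo] --> (1 : R).
Proof. by under eq_fun do rewrite cdfE; apply: fine_cvg; exact: cvg_cdfy1. Qed.

Let F_Ny : F x @[x --> -oo] --> (0 : R).
Proof. by under eq_fun do rewrite cdfE; apply: fine_cvg; exact: cvg_cdfNy0. Qed.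

Let F_rc x : F y @[y --> x^'+] --> F x.
Proof.
rewrite cdfE; under eq_fun do rewrite cdfE.
by apply: fine_cvg; rewrite fineK ?fin_num_measure//; exact: cdf_right_continuous.
Qed.

(** A Galois connection: the limits 0 and 1 of [F] make the infimum finite, and right continuity
    makes it attained. *)
Lemma gen_inv_le u x : 0 < u < 1 -> (gen_inv F u <= x) = (u <= F x).
Proof.
move=> /andP[u0 u1].
have lb : has_lbound [set x | u <= F x].
  have [y Fy] : exists y : R, F y < u.
    have := cvgr_lt _ F_Ny _ u0 => -[y [yr]] h; exists (y - 1).
    by apply: h; rewrite ltrBlDr ltrDl.
  exists y => z /= uz; rewrite leNgt; apply/negP => zy.
  by have := F_nd (ltW zy); rewrite leNgt (lt_le_trans Fy uz).
have ne : [set x | u <= F x] !=set0.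
  have := cvgr_gt _ F_y _ u1 => -[y [yr]] h; exists (y + 1) => /=.
  by apply: ltW; apply: h; rewrite ltrDl.
apply/idP/idP => [Qx|uF]; last exact: ge_inf.
have h e : 0 < e -> u <= F (x + e).
  move=> e0; have [z /= uz zQ] := inf_adherent e0 (conj ne lb).
  by apply: (le_trans uz); apply: F_nd; apply: ltW; apply: (lt_le_trans zQ); rewrite lerD2r.
rewrite leNgt; apply/negP => Fxu.
have Fu := cvgr_lt _ (@F_rc x) _ Fxu.
near x^'+ => y.
have xy : 0 < y - x by rewrite subr_gt0; near: y; exact: nbhs_right_gt.
have := h _ xy; rewrite addrC subrK leNgt => /negP; apply.
by near: y; exact: Fu.
Unshelve. all: by end_near. Qed.

(* Outside of ]0, 1[ the infimum in [gen_inv] may be taken over an empty or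
   unbounded set. *)
Definition quantile (u : R) : R := if 0 < u < 1 then gen_inv F u else 0.

(** Superlevel sets of the quantile are intervals of length 1 - F x, which settles both its
    measurability and its law. *)
Lemma quantile_le x : [set u | 0 < u < 1 /\ x < quantile u] = `]F x, 1%R[%classic.
Proof.
apply/seteqP; split => u /=; rewrite in_itv/=.
  move=> [u01]; rewrite /quantile u01 ltNge gen_inv_le// -ltNge => ->.
  by case/andP: u01.
move=> /andP[Fu u1].
have u01 : 0 < u < 1 by rewrite u1 andbT (le_lt_trans (cdf_rv_ge0 x)).
by split => //; rewrite /quantile u01 ltNge gen_inv_le// -ltNge.
Qed.

Lemma measurable_quantile : measurable_fun [set: measurableTypeR R] quantile.
Proof.
apply: (measurability _ (RGenOInfty.measurableE R)) => _ [_ [x ->] <-].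
rewrite setTI.
rewrite (_ : _ @^-1` _ = `]F x, 1%R[ `|` (~` `]0, 1[ `&` [set u | x < 0])).
  apply: measurableU => //; apply: measurableI; first exact: measurableC.
  have [x0|x0] := ltP x 0.
    by rewrite (_ : [set _ | _] = setT)//; apply/seteqP; split.
  by rewrite (_ : [set _ | _] = set0)//; apply/seteqP; split => // u.
rewrite -quantile_le; apply/seteqP; split => u /=; rewrite !in_itv/= andbT.
  move=> xu; have [u01|u01] := boolP (0 < u < 1); [by left|right].
  by move: xu; rewrite /quantile (negbTE u01); split => //; exact/negP.
by move=> [[]//|[/negP u01 x0]]; rewrite /quantile (negbTE u01).
Qed.

Definition unif01 : set (measurableTypeR R) -> \bar R :=
  mrestr mu (measurable_itv `]0%R, 1%R[).

HB.instance Definition _ := Measure.on unif01.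

Lemma unif01_setT : unif01 [set: R] = 1%E.
Proof. by rewrite /unif01 /mrestr setTI lebesgue_measure_itv/= lte_fin ltr01 oppr0 adde0. Qed.

HB.instance Definition _ := Measure_isProbability.Build _ _ _ unif01 unif01_setT.

Definition quantile_rv : {RV unif01 >-> R} := MeasurableFun.Pack (MeasurableFun.Class
  (isMeasurableFun.Build _ _ _ _ _ measurable_quantile)).

(** The quantile transform of a uniform variable. Open upper rays are stable under intersection and
    generate the Borel sets, so agreement on them is enough. *)
Lemma quantile_law (A : set R) : measurable A ->
  P (X @^-1` A) = unif01 (quantile @^-1` A).
Proof.
move=> mA.
pose m2 : {measure set R -> \bar R} := distribution unif01 quantile_rv.
pose m1 : {measure set R -> \bar R} := distribution P X.
have h x : P (X @^-1` `]x, +oo[) = unif01 (quantile @^-1` `]x, +oo[).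
  have -> : unif01 (quantile @^-1` `]x, +oo[) = (1 - F x)%:E.
    rewrite /unif01 /mrestr.
    have -> : quantile @^-1` `]x, +oo[ `&` `]0%R, 1%R[ = `]F x, 1%R[%classic.
      rewrite -quantile_le; apply/seteqP; split => u /=; rewrite !in_itv/= andbT.
        by move=> [].
      by move=> [].
    rewrite lebesgue_measure_itv/= lte_fin; case: ltP => [//|F1].
    by congr EFin; apply/eqP; rewrite eq_sym subr_eq0 eq_le F1 cdf_rv_le1.
  have -> : X @^-1` `]x, +oo[ = ~` [set w | X w <= x].
    by apply/seteqP; split => w /=; rewrite in_itv/= andbT ltNge => /negP.
  have mx : measurable [set w | X w <= x].
    rewrite (_ : [set _ | _] = X @^-1` `]-oo, x]); first exact: measurable_funPTI.
    by apply/seteqP; split => w /=; rewrite in_itv.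
  by rewrite probability_setC// /F /cdf_rv EFinB fineK// fin_num_measure.
have := @measure_unique _ R R (@RGenOInfty.G R) (fun n => `](- n%:R)%R, +oo[%classic)
  (RGenOInfty.measurableE R) _ _ _ m1 m2 _ _ A mA.
apply.
- move=> _ _ [x ->] [y ->]; exists (Num.max x y).
  apply/seteqP; split => z /=; rewrite !in_itv/= !andbT gt_max.
    by move=> [-> ->].
  by move=> /andP[-> ->].
- by move=> n; exists (- n%:R).
- apply/seteqP; split => // x _; exists (Num.truncn `|x|).+1 => //=.
  rewrite in_itv/= andbT ltrNl; apply: le_lt_trans (truncnS_gt _).
  by rewrite -normrN ler_norm.
- by move=> _ [x ->]; exact: h.
- by move=> k; rewrite (le_lt_trans (probability_le1 _ _))// ltry.
Qed.

Lemma Rintegral_quantile (g : R -> R) : measurable_fun [set: R] g ->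
  P.-integrable [set: T] (EFin \o (g \o X)) ->
  unif01.-integrable [set: R] (EFin \o (g \o quantile)) /\
  \int[P]_w g (X w) = \int[unif01]_u g (quantile u).
Proof.
move=> mg ig.
have mEg : measurable_fun [set: R] (EFin \o g) by exact/measurable_EFinP.
have e (f : R -> \bar R) : (\int[distribution P X]_x f x =
    \int[distribution unif01 quantile_rv]_x f x)%E.
  by apply: eq_measure_integral => A mA _; exact: quantile_law.
have iq : unif01.-integrable [set: R] (EFin \o (g \o quantile)).
  apply/integrableP; split; first exact: (measurableT_comp mEg measurable_quantile).
  have /integrableP[_] := ig.
  have ma : measurable_fun [set: R] (fun x => `|(EFin \o g) x|%E).
    exact: measurableT_comp.
  have := e (fun x => `|(EFin \o g) x|%E).
  by rewrite !ge0_integral_distribution// => ->.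
split => //; rewrite /Rintegral; congr fine.
have := e (EFin \o g).
by rewrite !integral_distribution.
Qed.

End quantile.

(** Both laws are realised on one uniform variable through their quantiles, which are pointwise
    within [B]. The majorant [G] is evaluated at the second point so that its mean is taken under
    [L], where the equilibrium identity is available. *)
Lemma quantile_coupling d (T : measurableType d) (R : realType) (P : probability T R)
    (X : {RV P >-> R}) (L : probability R R) (B M : R) (g G : R -> R) :
  (forall u, 0 < u < 1 -> `|gen_inv (cdf_rv P X) u - gen_inv (cdf_law L) u| <= B) ->
  measurable_fun [set: R] g -> measurable_fun [set: R] G ->
  (forall x, `|g x| <= M) -> (forall x, `|G x| <= M) ->
  (forall x y, `|x - y| <= B -> `|g x - g y| <= G y) ->
  `|\int[P]_w g (X w) - \int[L]_x g x| <= \int[L]_x G x.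
Proof.
move=> QB mg mG gM GM gG.
have B0 : 0 <= B by apply: le_trans (QB (2^-1) _); rewrite ?invr_gt0//=; lra.
(* The law [L] as a random variable: the identity on its own space, whose [cdf_rv] is
   [cdf_law L]. *)
pose I : {RV L >-> R} := MeasurableFun.Pack (MeasurableFun.Class
  (isMeasurableFun.Build _ _ _ _ _ (@measurable_id _ R setT))).
have bi d' (T' : measurableType d') (P' : probability T' R) (Z : {RV P' >-> R}) (f : R -> R) :
    measurable_fun [set: R] f -> (forall x, `|f x| <= M) ->
    P'.-integrable [set: T'] (EFin \o (f \o Z)).
  move=> mf fM; apply: (@integrable_bounded _ _ _ _ _ M) => [|x]; last exact: fM.
  exact: measurableT_comp.
have [i1 ->] := Rintegral_quantile mg (bi _ _ _ X _ mg gM).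
have [i2 e2] := Rintegral_quantile mg (bi _ _ _ I _ mg gM).
have [i3 e3] := Rintegral_quantile mG (bi _ _ _ I _ mG GM).
rewrite [X in _ - X]e2 [leRHS]e3 -RintegralB//.
apply: (le_trans (le_normr_Rintegral _ _)) => //; first exact: (integrableB _ i1 i2).
apply: le_Rintegral => //.
- exact: (integrable_abse (integrableB measurableT i1 i2)).
(* Outside ]0, 1[ both quantiles have the default value 0, so [B0] suffices there. *)
- move=> u _; apply: gG; rewrite /quantile; case: ifPn => u01; first exact: QB.
  by rewrite subrr normr0.
Qed.

(** * Upper bounds *)

Section real_lemmas.
Context {R : realType}.

Lemma is_derive_continuous (f df : R -> R) :
  (forall x : R, is_derive x 1 f (df x)) -> continuous f.
Proof.
move=> fd x; have [+ _] := fd x.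
by move=> /derivable1_diffP/differentiable_continuous.
Qed.

Lemma is_derive_shift (f df : R -> R) (c x : R) :
  (forall x : R, is_derive x 1 f (df x)) -> is_derive x 1 (fun x => f (x + c)) (df (x + c)).
Proof.
move=> fd.
have lin : is_derive x 1 (fun x : R => x + c) 1.
  by apply: is_derive_eq; rewrite addr0.
have H := @is_derive1_comp R f (fun x => x + c) x _ _ (fd _) lin.
by apply: (is_derive_eq H); rewrite mulr1.
Qed.

Lemma MVT_increment (f df : R -> R) (x y : R) :
  (forall x : R, is_derive x 1 f (df x)) ->
  exists2 z, `|z - x| <= `|y - x| & f y - f x = df z * (y - x).
Proof.
move=> fd.
have cf : continuous f by exact: is_derive_continuous fd.
have [xy|/ltW yx] := leP x y.
  have [|z] := @MVT_segment _ f df x y xy (fun z _ => fd z).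
    exact: continuous_subspaceT.
  rewrite in_itv/= => /andP[xz zy] e; exists z => //.
  by rewrite !ger0_norm ?subr_ge0// lerD2r.
have [|z] := @MVT_segment _ f df y x yx (fun z _ => fd z).
  exact: continuous_subspaceT.
rewrite in_itv/= => /andP[yz zx] e; exists z.
  by rewrite !ler0_norm ?subr_le0// !opprB lerD2l lerN2.
by rewrite -[LHS]opprB e -mulrN opprB.
Qed.

Lemma is_derive_lipschitz (K : R) (f df : R -> R) :
  (forall x : R, is_derive x 1 f (df x)) -> (forall x, `|df x| <= K) -> lipschitz_by K f.
Proof.
move=> fd dfK x y; have [z _ ->] := MVT_increment y x fd.
by rewrite normrM ler_wpM2r.
Qed.

(** Two mean value steps, with [K] in place of the sharp K / 6. The loss is affordable: with K = 4 /
    sigma^2 the cubic term is exactly the rho term of the Wasserstein bound. *)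
Lemma taylor2_lipschitz (K : R) (f f1 f2 : R -> R) (y t : R) : 0 <= K ->
  (forall x : R, is_derive x 1 f (f1 x)) -> (forall x : R, is_derive x 1 f1 (f2 x)) ->
  lipschitz_by K f2 ->
  `|f (y + t) - f y - t * f1 y - t ^+ 2 / 2 * f2 y| <= K * `|t| ^+ 3.
Proof.
move=> K0 fd f1d f2K.
pose g u := f (y + u) - f y - u * f1 y - u ^+ 2 / 2 * f2 y.
pose g1 u := f1 (y + u) - f1 y - u * f2 y.
have gd (u : R) : is_derive u 1 g (g1 u).
  have h := is_derive1_comp (fd (y + u)) (is_deriveD (is_derive_cst y u 1) (is_derive_id u (1:R))).
  rewrite /g; apply: is_derive_eq.
  by rewrite /g1 /GRing.scale/=; field.
have g1d (u : R) : is_derive u 1 g1 (f2 (y + u) - f2 y).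
  have h := is_derive1_comp (f1d (y + u)) (is_deriveD (is_derive_cst y u 1) (is_derive_id u (1:R))).
  rewrite /g1; apply: is_derive_eq.
  by rewrite /GRing.scale/=; ring.
have g0 : g 0 = 0 by rewrite /g addr0 subrr expr0n/= !mul0r !subr0.
have g10 : g1 0 = 0 by rewrite /g1 addr0 subrr mul0r subr0.
have [z zt] := MVT_increment 0 t gd; rewrite g0 !subr0 in zt * => gt.
have [v vz] := MVT_increment 0 z g1d; rewrite g10 !subr0 in vz * => gz.
rewrite -/(g t) gt gz !normrM exprS expr2 !mulrA.
rewrite ler_wpM2r// ler_pM//.
apply: (le_trans (f2K _ _)); rewrite addrC addKr ler_wpM2l//; exact: (le_trans vz zt).
Qed.

(** Discounted telescoping: multiplied by (1 - p)^j, the terms [a] cancel in pairs. In use, [a] and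
    [c] are the means of [f] and [h] at the partial sums, and [r] is the residual of one step. *)
Lemma geometric_telescope (p : R) (a c r : nat -> R) n :
  (forall j, (1 - p) * a j.+1 - a j + p * c j.+1 = p * r j) ->
  \sum_(j < n) p * (1 - p) ^+ j * c j.+1 =
  a 0%N - (1 - p) ^+ n * a n + \sum_(j < n) p * (1 - p) ^+ j * r j.
Proof.
move=> h; elim: n => [|n IH]; first by rewrite !big_ord0 expr0 mul1r subrr addr0.
rewrite !big_ord_recr/= IH.
have -> : p * (1 - p) ^+ n * r n = (1 - p) ^+ n * (p * r n) by ring.
by rewrite -h exprS; ring.
Qed.

(** With r = sqrt q, nonnegativity of the partial sums in [sum_geometricM] bounds n r^n; the spare
    factor r^n tends to 0. *)
Lemma cvg_natrM_expr (q : R) : 0 < q < 1 -> (n%:R * q ^+ n) @[n --> \oo] --> (0 : R).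
Proof.
move=> /andP[q0 q1].
pose r := Num.sqrt q.
have r0 : 0 < r by rewrite sqrtr_gt0.
have rr : q = r * r by rewrite -expr2 sqr_sqrtr// ltW.
have r1 : r < 1 by rewrite -sqrtr1 ltr_sqrt.
have r1' : 0 < 1 - r by rewrite subr_gt0.
have rn n : n%:R * r ^+ n <= (1 - r)^-1.
  have p01 : 0 < 1 - r < 1 by rewrite r1'/= ltrBlDr ltrDl.
  have := sum_geometricM p01 n; rewrite subKr => e.
  have s0 : 0 <= \sum_(j < n) (1 - r) * r ^+ j * j.+1%:R.
    by apply: sumr_ge0 => j _; rewrite !mulr_ge0 ?exprn_ge0// ltW.
  have : (1 - r ^+ n) / (1 - r) <= (1 - r)^-1.
    by rewrite ler_pdivrMr// mulVf ?gt_eqF// gerBl exprn_ge0// ltW.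
  by move: s0; rewrite e; lra.
apply: (@squeeze_cvgr _ _ _ _ (cst 0) (fun n => (1 - r)^-1 * r ^+ n)).
- apply: nearW => n; rewrite mulr_ge0 ?exprn_ge0 ?(ltW q0)//=.
  by rewrite rr exprMn mulrA ler_wpM2r ?exprn_ge0 ?(ltW r0).
- exact: cvg_cst.
- rewrite -[X in _ --> X](mulr0 (1 - r)^-1); apply: cvgM; first exact: cvg_cst.
  by apply: cvg_expr; rewrite ger0_norm// ltW.
Qed.

End real_lemmas.

Lemma Rintegral_prob_cst d (T : measurableType d) (R : realType) (P : probability T R)
  (c : R) : \int[P]_w c = c.
Proof. by rewrite Rintegral_cst//= probability_setT mulr1. Qed.

(** * Stein's method for the geometric sum *)

Section geometric_sum.
Context d (T : measurableType d) (R : realType) (P : probability T R).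
Variables (X : nat -> {RV P >-> R}) (sigma p : R) (N : T -> nat).
Hypothesis sigma0 : 0 < sigma.
Hypothesis p01 : 0 < p < 1.
Hypothesis EX0 : forall i, 'E_P[X i] = 0%E.
Hypothesis EX2 : forall i, 'E_P[fun w => (X i w ^+ 2)%R] = (sigma ^+ 2)%:E.
Hypothesis geoN : geometric_rv P N p.
Hypothesis indX : mutually_independent P
  (fun o : option nat => match o with
                         | None => fun w => (N w)%:R
                         | Some i => (X i : T -> R) end).

Let k := Num.sqrt p.
Let b := sigma / Num.sqrt 2.

Let p0 : 0 < p. Proof. by case/andP: p01. Qed.
Let p1 : p < 1. Proof. by case/andP: p01. Qed.
Let q0 : 0 < 1 - p. Proof. by rewrite subr_gt0. Qed.
Let q1 : 1 - p < 1. Proof. by rewrite ltrBlDr ltrDl. Qed.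
Let k0 : 0 < k. Proof. by rewrite sqrtr_gt0. Qed.
Let kk : k * k = p. Proof. by rewrite -expr2 sqr_sqrtr// ltW. Qed.
Let b0 : 0 < b. Proof. by rewrite divr_gt0// sqrtr_gt0. Qed.
Let bb : b ^+ 2 = sigma ^+ 2 / 2. Proof. by rewrite exprMn exprVn sqr_sqrtr. Qed.

Let mN := geoN.1.
Let pN := geoN.2.

Lemma integrable_sqr i : P.-integrable [set: T] (EFin \o (fun w => X i w ^+ 2)).
Proof.
apply/integrableP; split.
  by apply/measurable_EFinP; exact: measurable_funX.
have := EX2 i; rewrite unlock => e.
rewrite (_ : (\int[P]_x _)%E = (sigma ^+ 2)%:E) ?ltry// -e.
by apply: eq_integral => w _ /=; rewrite ger0_norm// sqr_ge0.
Qed.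

Lemma Rintegral_sqr i : \int[P]_w (X i w ^+ 2) = sigma ^+ 2.
Proof. by rewrite /Rintegral; have := EX2 i; rewrite unlock => ->. Qed.

(** The arithmetic-geometric mean inequality, scaled by [sigma] so that integrating it gives E |X i|
    <= sigma. *)
Let abs_le (x : R) : `|x| <= 2^-1 * (sigma + sigma^-1 * x ^+ 2).
Proof.
have e : 2^-1 * (sigma + sigma^-1 * x ^+ 2) - `|x| = (2 * sigma)^-1 * (sigma - `|x|) ^+ 2.
  by rewrite -[x ^+ 2]real_normK ?num_real//; field; rewrite gt_eqF.
by rewrite -subr_ge0 e mulr_ge0 ?sqr_ge0// invr_ge0 mulr_ge0// ltW.
Qed.

Let iq i : P.-integrable [set: T] (EFin \o (fun w => 2^-1 * (sigma + sigma^-1 * X i w ^+ 2))).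
Proof.
have i1 := integrableZl measurableT (sigma^-1) (integrable_sqr i).
have i2 := integrableD measurableT (finite_measure_integrable_cst P sigma measurableT) i1.
exact: (integrableZl measurableT (2^-1) i2).
Qed.

Lemma integrable_X i : P.-integrable [set: T] (EFin \o X i).
Proof.
apply: (le_integrable _ _ _ (iq i)) => //; first exact/measurable_EFinP.
by move=> w _ /=; rewrite lee_fin (le_trans (abs_le _))// ler_norm.
Qed.

Lemma Rintegral_X i : \int[P]_w X i w = 0.
Proof. by rewrite /Rintegral; have := EX0 i; rewrite unlock => ->. Qed.

Lemma Rintegral_normX i : \int[P]_w `|X i w| <= sigma.
Proof.
apply: (@le_trans _ _ (\int[P]_w (2^-1 * (sigma + sigma^-1 * X i w ^+ 2)))).
  apply: le_Rintegral => //; exact: (integrable_abse (integrable_X i)).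
have i1 := integrableZl measurableT (sigma^-1) (integrable_sqr i).
have ic := finite_measure_integrable_cst P sigma measurableT.
rewrite RintegralZl//; last exact: (integrableD measurableT ic i1).
rewrite RintegralD// RintegralZl//; last exact: integrable_sqr.
rewrite Rintegral_sqr Rintegral_prob_cst.
rewrite expr2 mulrA mulVf ?gt_eqF// mul1r; lra.
Qed.

Section test_functions.
Variables f h : R -> R.
Hypotheses (mf : measurable_fun [set: R] f) (mh : measurable_fun [set: R] h).
Hypotheses (lf : linear_growth f) (lh : linear_growth h).

Let measurable_scale (g : R -> R) : measurable_fun [set: R] g ->
  measurable_fun [set: R] (fun x => g (k * x)).
Proof. by move=> mg; apply: (measurableT_comp mg); exact: measurable_funM. Qed.

Let linear_growth_scale (g : R -> R) : linear_growth g -> linear_growth (fun x => g (k * x)).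
Proof.
move=> [K gK]; exists K => x; apply: (le_trans (gK _)); apply: ler_wpM2l.
  by have := le_trans (normr_ge0 _) (gK 0); rewrite normr0 addr0 mulr1.
rewrite lerD2l normrM ler_piMl// ger0_norm ?ltW//.
by rewrite -sqrtr1 ltr_sqrt.
Qed.

Let a j := \int[P]_w f (k * psum X j w).
Let c j := \int[P]_w h (k * psum X j w).
Let G j s := \int[P]_v ((1 - p) * f (k * (s + X j v)) + p * h (k * (s + X j v))).

(** Conditioning on the first [j] summands: [G j s] is the mean of (1 - p) f + p h one summand after
    [s]. The residual can therefore be bounded pointwise in [s]. *)
Lemma stein_step j :
  P.-integrable [set: T] (fun w => (G j (psum X j w) - f (k * psum X j w))%:E) /\
  (1 - p) * a j.+1 - a j + p * c j.+1 =
    \int[P]_w (G j (psum X j w) - f (k * psum X j w)).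
Proof.
pose g x := (1 - p) * f (k * x) + p * h (k * x).
have mg : measurable_fun [set: R] g.
  by apply: measurable_funD; apply: measurable_funM => //; exact: measurable_scale.
have lg : linear_growth g.
  have [K fK] := linear_growth_scale lf; have [K' hK] := linear_growth_scale lh.
  exists (K + K') => x; apply: (le_trans (ler_normD _ _)); rewrite !normrM mulrDl lerD//.
    apply: le_trans (fK x); rewrite ler_piMl// ger0_norm ltW//.
  apply: le_trans (hK x); rewrite ler_piMl// ger0_norm ltW//.
have [i1 e1] := Rintegral_psumS mN indX integrable_X j mg lg.
have iS n (u : R -> R) : measurable_fun [set: R] u -> linear_growth u ->
    P.-integrable [set: T] (EFin \o (fun w => u (k * psum X n w))).
  move=> mu lu; have := integrable_linear_growth (measurable_scale mu)
    (linear_growth_scale lu) (integrable_psum integrable_X n).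
  exact.
have if0 := iS j f mf lf; have if1 := iS j.+1 f mf lf; have ih1 := iS j.+1 h mh lh.
split; first exact: (integrableB measurableT i1 if0).
rewrite RintegralB// -e1 RintegralD//; last 2 first.
- exact: (integrableZl measurableT _ if1).
- exact: (integrableZl measurableT _ ih1).
by rewrite !RintegralZl// /a /c addrAC.
Qed.

(** The finite telescoping passed to the limit. For a Stein solution f 0 is E h(Z), so the work
    reduces to a vanishing boundary term and a bound on the weighted residuals. *)
Lemma stein_limit (r : nat -> R) (E : R) :
  (forall j, \int[P]_w (G j (psum X j w) - f (k * psum X j w)) = p * r j) ->
  ((1 - p) ^+ n * a n) @[n --> \oo] --> (0 : R) ->
  (forall n, `|\sum_(j < n) p * (1 - p) ^+ j * r j| <= E) ->
  P.-integrable [set: T] (fun w => (h (k * rsum X N w))%:E) ->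
  `|\int[P]_w h (k * rsum X N w) - f 0| <= E.
Proof.
move=> rE a0 rle ih.
have tel n := @geometric_telescope R p a c r n (fun j => etrans (stein_step j).2 (rE j)).
have cv : (\sum_(j < n) p * (1 - p) ^+ j * c j.+1) @[n --> \oo] -->
    \int[P]_w h (k * rsum X N w).
  by apply: (cvg_geometric_mixture mN indX integrable_X p01 pN
    (measurable_scale mh) (linear_growth_scale lh)).
have cv2 : (\sum_(j < n) p * (1 - p) ^+ j * c j.+1 - f 0 + (1 - p) ^+ n * a n) @[n --> \oo]
    --> \int[P]_w h (k * rsum X N w) - f 0 + 0.
  by apply: cvgD => //; apply: cvgB => //; exact: cvg_cst.
rewrite addr0 in cv2.
have aE : a 0%N = f 0.
  rewrite /a; under eq_Rintegral do rewrite /psum big_ord0 mulr0.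
  by rewrite Rintegral_prob_cst.
apply: (ler_cvg_to (cvg_norm cv2) (cvg_cst E)).
apply: nearW => n; rewrite tel aE.
by rewrite (_ : f 0 - _ + _ - _ + _ = \sum_(j < n) p * (1 - p) ^+ j * r j) ?rle//; ring.
Qed.

End test_functions.

Lemma lipschitz_linear_growth (C : R) (f : R -> R) : lipschitz_by C f -> linear_growth f.
Proof.
move=> fC; exists (`|f 0| + `|C|) => x.
have h1 : `|f x| <= `|f 0| + C * `|x|.
  have := fC x 0; rewrite subr0 => h.
  by rewrite -[f x](subrK (f 0)) (le_trans (ler_normD _ _))// addrC lerD2l.
apply: (le_trans h1); rewrite mulrDl lerD//.
  by rewrite ler_peMr// lerDl.
by rewrite (le_trans (ler_wpM2r _ (ler_norm C)))// ler_wpM2l// lerDr.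
Qed.

Lemma sum_geometric_le (r : nat -> R) (E : R) n : 0 <= E -> (forall j, `|r j| <= E) ->
  `|\sum_(j < n) p * (1 - p) ^+ j * r j| <= E.
Proof.
move=> E0 rE; apply: (le_trans (ler_norm_sum _ _ _)).
apply: (@le_trans _ _ (\sum_(j < n) p * (1 - p) ^+ j * E)).
  apply: ler_sum => j _; rewrite normrM ger0_norm ?mulr_ge0 ?exprn_ge0 ?(ltW p0) ?(ltW q0)//.
  by rewrite ler_wpM2l// mulr_ge0 ?exprn_ge0 ?(ltW p0) ?(ltW q0).
rewrite -mulr_suml sum_geometric ler_piMl// gerBl exprn_ge0//; exact: ltW.
Qed.

(** * Wasserstein distance: Taylor expansion with third moments *)

Section wasserstein.
Variables (h : R -> R) (rho : R).
Hypothesis h1 : lipschitz_by 1 h.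
Hypothesis iX3 : forall i, P.-integrable [set: T] (EFin \o (fun w => `|X i w| ^+ 3)).
Hypothesis X3 : forall i, \int[P]_w (`|X i w| ^+ 3) <= rho.

Let f := stein_sol b h.
Let f1 := stein_sol' b h.
Let f2 x := (f x - h x) / b ^+ 2.
Let K := 2 / b ^+ 2.

Let df (x : R) : is_derive x 1 f (f1 x). Proof. exact: (is_derive_stein_sol b0 ler01 h1 x). Qed.
Let df1 (x : R) : is_derive x 1 f1 (f2 x). Proof. exact: (is_derive_stein_sol' b0 ler01 h1 x). Qed.
Let f_lip : lipschitz_by 1 f.
Proof. by apply: is_derive_lipschitz df _ => x; exact: stein_sol'_lipschitz. Qed.
Let b20 : 0 < b ^+ 2. Proof. by rewrite exprn_gt0. Qed.
Let K0 : 0 <= K. Proof. by rewrite divr_ge0// ltW. Qed.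

Let f2_lip : lipschitz_by K f2.
Proof.
move=> x y; rewrite /f2 -mulrBl normrM (ger0_norm (_ : 0 <= (b ^+ 2)^-1)) ?invr_ge0 ?(ltW b20)//.
rewrite /K mulrAC ler_pM2r ?invr_gt0//.
have -> : f x - h x - (f y - h y) = (f x - f y) - (h x - h y) by ring.
apply: (le_trans (ler_normB _ _)).
by have := f_lip x y; have := h1 x y; rewrite !mul1r; lra.
Qed.

Let mh : measurable_fun [set: R] h.
Proof. by apply: continuous_measurable_fun; exact: lipschitz_by_continuous h1. Qed.
Let mf : measurable_fun [set: R] f.
Proof. by apply: continuous_measurable_fun; exact: lipschitz_by_continuous f_lip. Qed.

Lemma wasserstein_step j s :
  `|\int[P]_v ((1 - p) * f (k * (s + X j v)) + p * h (k * (s + X j v))) - f (k * s)|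
    <= p * (k * K * (rho + b ^+ 2 * sigma)).
Proof.
pose y := k * s.
pose D v := (1 - p) * f (k * (s + X j v)) + p * h (k * (s + X j v)) - f y.
have iXj := integrable_X j.
have iu (u : R -> R) : lipschitz_by 1 u ->
    P.-integrable [set: T] (EFin \o (fun v => u (k * (s + X j v)))).
  move=> u1.
  have mu : measurable_fun [set: R] u.
    by apply: continuous_measurable_fun; exact: lipschitz_by_continuous u1.
  have i0 := integrableZl measurableT k (integrable_addr s iXj).
  exact: (@integrable_linear_growth _ _ _ _ (fun v => k * (s + X j v)) _ mu
    (lipschitz_linear_growth u1) i0).
have iF := integrableZl measurableT (1 - p) (iu _ f_lip).
have iH := integrableZl measurableT p (iu _ h1).
have iFH := integrableD measurableT iF iH.
have iC (x : R) := finite_measure_integrable_cst P x measurableT.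
have iD : P.-integrable [set: T] (EFin \o D) by exact: (integrableB measurableT iFH (iC (f y))).
have -> : \int[P]_v ((1 - p) * f (k * (s + X j v)) + p * h (k * (s + X j v))) - f y = \int[P]_v D v.
  rewrite [RHS]RintegralB//; last exact: iC.
  by rewrite Rintegral_prob_cst.
(* Coefficients of the two Taylor terms of [f] at [y] and of the correction p b^2 f'' y. The
   combination has mean zero, since E X = 0 and p sigma^2 / 2 = p b^2, so subtracting it from [D]
   changes no integral. *)
pose c1 := k * f1 y.
pose c2 := 2^-1 * p * f2 y.
pose c3 := p * b ^+ 2 * f2 y.
have i1 := integrableZl measurableT c1 iXj.
have i2 := integrableZl measurableT c2 (integrable_sqr j).
have i12 := integrableD measurableT i1 i2.
have i123 := integrableB measurableT i12 (iC c3).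
pose D' v := D v - (c1 * X j v + c2 * X j v ^+ 2 - c3).
have iD' : P.-integrable [set: T] (EFin \o D') by exact: (integrableB measurableT iD i123).
have <- : \int[P]_v D' v = \int[P]_v D v.
  have e0 : \int[P]_v (c1 * X j v + c2 * X j v ^+ 2 - c3) = 0.
    rewrite RintegralB//; last exact: iC.
    rewrite [X in _ - X]Rintegral_prob_cst.
    rewrite RintegralD// !RintegralZl//; last exact: integrable_sqr.
    rewrite Rintegral_X Rintegral_sqr.
    by rewrite /c2 /c3 bb; field.
  by rewrite [LHS]RintegralB// e0 subr0.
have i3 := integrableZl measurableT (K * k ^+ 3) (iX3 j).
have i4 := integrableZl measurableT (p * b ^+ 2 * K * k) (integrable_abse iXj).
apply: (@le_trans _ _ (\int[P]_v (K * k ^+ 3 * `|X j v| ^+ 3 + p * b ^+ 2 * K * k * `|X j v|))).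
  apply: (le_trans (le_normr_Rintegral _ _)) => //.
  apply: le_Rintegral => //.
  - exact: integrable_abse iD'.
  - exact: (integrableD measurableT i3 i4).
  move=> v _.
  pose t := k * X j v.
  have nt : `|t| = k * `|X j v| by rewrite normrM (gtr0_norm k0).
  (* Substituting (1 - p) f + p h = f - p b^2 f'' leaves a Taylor remainder and an increment of f'',
     both controlled by the Lipschitz constant [K]. *)
  have -> : D' v = (f (y + t) - f y - t * f1 y - t ^+ 2 / 2 * f2 y) -
      p * b ^+ 2 * (f2 (y + t) - f2 y).
    rewrite /D' /D /c1 /c2 /c3 /f2 (_ : k * (s + X j v) = y + t); last by rewrite mulrDr.
    move: (f (y + t)) (h (y + t)) (f y) (h y) (f1 y) => F1 H1 F0 H0 F'.
    have -> : t ^+ 2 = p * X j v ^+ 2 by rewrite exprMn expr2 kk.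
    rewrite /t; move: b20; move: (b ^+ 2) => B B0.
    by field; rewrite gt_eqF.
  apply: (le_trans (ler_normB _ _)); apply: lerD.
    apply: (le_trans (taylor2_lipschitz y t K0 df df1 f2_lip)).
    by rewrite nt exprMn mulrA.
  have pb0 : 0 <= p * b ^+ 2 := mulr_ge0 (ltW p0) (ltW b20).
  rewrite normrM (ger0_norm pb0).
  have -> : p * b ^+ 2 * K * k * `|X j v| = p * b ^+ 2 * (K * `|t|) by rewrite nt; ring.
  rewrite ler_wpM2l//.
  by have := f2_lip (y + t) y; rewrite (_ : y + t - y = t)//; ring.
rewrite RintegralD// !RintegralZl//; last exact: integrable_abse iXj.
have -> : p * (k * K * (rho + b ^+ 2 * sigma)) = K * k ^+ 3 * rho + p * b ^+ 2 * K * k * sigma.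
  by rewrite -kk; ring.
apply: lerD; apply: ler_wpM2l.
- by rewrite mulr_ge0// exprn_ge0// ltW.
- exact: X3.
- by apply: mulr_ge0 (ltW k0); apply: mulr_ge0 K0; exact: mulr_ge0 (ltW p0) (ltW b20).
- exact: Rintegral_normX.
Qed.

Lemma wasserstein_test :
  `|\int[P]_w h (k * rsum X N w) - f 0| <= k * K * (rho + b ^+ 2 * sigma).
Proof.
have rho0 : 0 <= rho.
  by apply: le_trans (X3 0%N); apply: Rintegral_ge0 => w _; rewrite exprn_ge0.
have lf := lipschitz_linear_growth f_lip; have lh := lipschitz_linear_growth h1.
have E0 : 0 <= k * K * (rho + b ^+ 2 * sigma).
  apply: mulr_ge0; first exact: mulr_ge0 (ltW k0) K0.
  by apply: addr_ge0 => //; exact: mulr_ge0 (ltW b20) (ltW sigma0).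
have ipsum n : P.-integrable [set: T] (EFin \o (fun w => k * psum X n w)).
  exact: (integrableZl measurableT k (integrable_psum integrable_X n)).
pose r j := p^-1 * \int[P]_w
  (\int[P]_v ((1 - p) * f (k * (psum X j w + X j v)) + p * h (k * (psum X j w + X j v))) -
   f (k * psum X j w)).
apply: (stein_limit mf mh lf lh (r := r)).
- by move=> j; rewrite /r mulrA mulfV ?mul1r// gt_eqF.
(* Here [f] may be unbounded. Its mean grows at most linearly in n, which (1 - p)^n still beats. *)
- have an n : `|\int[P]_w f (k * psum X n w)| <= `|f 0| + k * sigma * n%:R.
    have i1 := integrable_linear_growth mf lf (ipsum n).
    have iC := finite_measure_integrable_cst P `|f 0| measurableT.
    have i2 := integrable_abse (ipsum n).
    apply: (le_trans (le_normr_Rintegral _ i1)) => //.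
    apply: (@le_trans _ _ (\int[P]_w (`|f 0| + `|k * psum X n w|))).
      apply: le_Rintegral => //.
      - exact: integrable_abse i1.
      - exact: (integrableD measurableT iC i2).
      move=> w _; have := f_lip (k * psum X n w) 0; rewrite subr0 mul1r => fl.
      rewrite -[X in `|X| <= _](subrK (f 0)) (le_trans (ler_normD _ _))// addrC.
      by rewrite lerD2l.
    rewrite RintegralD// Rintegral_prob_cst lerD2l.
    under eq_Rintegral do rewrite normrM.
    rewrite RintegralZl//; last exact: (integrable_abse (integrable_psum integrable_X n)).
    rewrite (gtr0_norm k0) -mulrA ler_pM2l// mulrC.
    by apply: (Rintegral_norm_psum_le integrable_X); exact: Rintegral_normX.
  apply/norm_cvg0P.
  apply: (@squeeze_cvgr _ _ _ _ (cst 0)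
    (fun n => `|f 0| * (1 - p) ^+ n + k * sigma * (n%:R * (1 - p) ^+ n))).
  + apply: nearW => n /=; rewrite normr_ge0/= normrM ger0_norm ?exprn_ge0 ?(ltW q0)//.
    have -> : `|f 0| * (1 - p) ^+ n + k * sigma * (n%:R * (1 - p) ^+ n) =
      (1 - p) ^+ n * (`|f 0| + k * sigma * n%:R) by ring.
    by rewrite ler_wpM2l// exprn_ge0// ltW.
  + exact: cvg_cst.
  + rewrite -[X in _ --> X](_ : `|f 0| * 0 + k * sigma * 0 = 0); last by rewrite !mulr0 addr0.
    apply: cvgD; apply: cvgM; try exact: cvg_cst.
      by apply: cvg_expr; rewrite ger0_norm ?(ltW q0).
    by apply: cvg_natrM_expr; rewrite q0 q1.
- move=> n; apply: sum_geometric_le => // j.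
  rewrite /r normrM ger0_norm ?invr_ge0 ?(ltW p0)// ler_pdivrMl//.
  have [i1 _] := stein_step mf mh lf lh j.
  apply: (le_trans (le_normr_Rintegral _ i1)) => //.
  apply: (@le_trans _ _ (\int[P]_w (p * (k * K * (rho + b ^+ 2 * sigma))))).
    apply: le_Rintegral => //; first exact: integrable_abse i1.
      exact: finite_measure_integrable_cst.
    by move=> w _; exact: wasserstein_step.
  by rewrite Rintegral_prob_cst.
- have ir := integrable_rsum mN indX integrable_X p01 pN (Rintegral_normX).
  exact: (@integrable_linear_growth _ _ _ _ (fun w => k * rsum X N w) _ mh lh
    (integrableZl measurableT k ir)).
Qed.

End wasserstein.

Lemma bounded_linear_growth (M : R) (f : R -> R) : (forall x, `|f x| <= M) -> linear_growth f.
Proof.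
move=> fM; exists M => x; apply: (le_trans (fM x)).
by rewrite ler_peMr ?lerDl// (le_trans _ (fM 0)).
Qed.

(** The equilibrium identity for the map sending x to g (k (s + x)): two derivatives produce k^2 =
    p, and half the second moment is b^2. The bound [M] supplies integrability on both sides. *)
Lemma equilibrium_shift j (L : probability R R) s (g g1 g2 : R -> R) (M : R) :
  equilibrium_law P (X j) L ->
  (forall x : R, is_derive x 1 g (g1 x)) -> (forall x : R, is_derive x 1 g1 (g2 x)) ->
  (forall x, `|g x| <= M) -> (forall x, `|g2 x| <= M) -> measurable_fun [set: R] g2 ->
  \int[P]_v g (k * (s + X j v)) - g (k * s) = p * b ^+ 2 * \int[L]_x g2 (k * (s + x)).
Proof.
move=> eqL gd g1d gM g2M mg2.
pose F x := g (k * (s + x)).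
pose F1 x := k * g1 (k * (s + x)).
pose F2 x := p * g2 (k * (s + x)).
have lin (x : R) : is_derive x 1 (fun x : R => k * (s + x)) k.
  by apply: is_derive_eq; rewrite /GRing.scale/=; ring.
have Fd (x : R) : is_derive x 1 F (F1 x).
  have := @is_derive1_comp R g (fun x => k * (s + x)) x _ _ (gd _) (lin x).
  by move=> H; apply: (is_derive_eq H); rewrite /F1 mulrC.
have F1d (x : R) : is_derive x 1 F1 (F2 x).
  have H := @is_derive1_comp R g1 (fun x => k * (s + x)) x _ _ (g1d _) (lin x).
  have H2 := is_deriveM (is_derive_cst k x (1:R)) H.
  apply: (is_derive_eq H2); rewrite /F2 -kk /GRing.scale/=; ring.
have dF : F^`()%classic = F1.
  by apply/funext => x; rewrite derive1E; have [_ ->] := Fd x.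
have ddF : F1^`()%classic = F2.
  by apply/funext => x; rewrite derive1E; have [_ ->] := F1d x.
have mg : measurable_fun [set: R] g.
  by apply: continuous_measurable_fun; exact: is_derive_continuous gd.
have ms u : measurable_fun [set: R] u -> measurable_fun [set: R] (fun x : R => u (k * (s + x)) : R).
  by move=> mu; apply: (measurableT_comp mu); apply: measurable_funM => //; exact: measurable_funD.
have iP : P.-integrable [set: T] (EFin \o (F \o X j)).
  apply: (@integrable_bounded _ _ _ _ _ M) => [|x]; last exact: gM.
  by apply: measurableT_comp => //; exact: ms.
have iL0 : L.-integrable [set: R] (EFin \o (fun x => g2 (k * (s + x)))).
  by apply: (@integrable_bounded _ _ _ _ _ M) => [|x]; [exact: ms|exact: g2M].
have iL : L.-integrable [set: R] (EFin \o F2) by exact: (integrableZl measurableT p iL0).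
have := eqL F; rewrite dF ddF => /(_ _ _ iP iL).
have -> : 'E_P[F \o X j] = (\int[P]_v g (k * (s + X j v)))%:E.
  by rewrite unlock /Rintegral fineK//; exact: integrable_fin_num iP.
have -> : (\int[L]_x (F2 x)%:E)%E = (p * \int[L]_x g2 (k * (s + x)))%:E.
  rewrite -RintegralZl// /Rintegral fineK//; exact: integrable_fin_num iL.
rewrite EX2 -EFinB -!EFinM /F addr0 => e.
have {}e := EFin_inj (e _ _); rewrite e.
- by rewrite bb; field.
- by move=> x; have [] := Fd x.
- by move=> x; have [] := F1d x.
Qed.

(** Summation by parts. Bounding every increment by 2 D separately would bring in the total weight 1
    / p. *)
Lemma abel_geometric (A : nat -> R) (D : R) n : (forall j, `|A j| <= D) ->
  - \sum_(j < n) (1 - p) ^+ j * (A j.+1 - A j) <= 2 * D.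
Proof.
move=> AD.
have D0 : 0 <= D by apply: le_trans (AD 0%N).
have e : \sum_(j < n) (1 - p) ^+ j * (A j.+1 - A j) =
    \sum_(j < n) p * (1 - p) ^+ j * A j.+1 - A 0%N + (1 - p) ^+ n * A n.
  elim: n => [|n IH]; first by rewrite !big_ord0 expr0 mul1r; ring.
  by rewrite !big_ord_recr/= IH exprS; ring.
have h1 : `|\sum_(j < n) p * (1 - p) ^+ j * A j.+1| <= (1 - (1 - p) ^+ n) * D.
  rewrite -sum_geometric mulr_suml; apply: (le_trans (ler_norm_sum _ _ _)).
  apply: ler_sum => j _; rewrite normrM ger0_norm ?mulr_ge0 ?exprn_ge0 ?(ltW p0) ?(ltW q0)//.
  by rewrite ler_wpM2l// mulr_ge0 ?exprn_ge0 ?(ltW p0) ?(ltW q0).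
have h2 : `|(1 - p) ^+ n * A n| <= (1 - p) ^+ n * D.
  by rewrite normrM ger0_norm ?exprn_ge0 ?(ltW q0)// ler_wpM2l// exprn_ge0// ltW.
move: h1 h2 (AD 0%N); rewrite e !ler_norml.
move: ((1 - p) ^+ n) (\sum_(j < n) _) => y S; lra.
Qed.

(** * Kolmogorov distance: equilibrium coupling for monotone test functions *)

Section kolmogorov.
Variables (L : nat -> probability R R) (B C : R) (h : R -> R).
Hypothesis eqL : forall i, equilibrium_law P (X i) (L i).
Hypothesis B0 : 0 <= B.
Hypothesis QB : forall i u, 0 < u < 1 ->
  `|gen_inv (cdf_rv P (X i)) u - gen_inv (cdf_law (L i)) u| <= B.
Hypothesis C0 : 0 <= C.
Hypothesis hC : lipschitz_by C h.
Hypothesis h01 : forall x, 0 <= h x <= 1.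
Hypothesis h_ni : forall x y, x <= y -> h y <= h x.

Let delta := k * B.
Let f := stein_sol b h.
Let f1 := stein_sol' b h.
Let f2 x := (f x - h x) / b ^+ 2.
Let phi x := f (x - delta) - f (x + delta).
Let phi1 x := f1 (x - delta) - f1 (x + delta).
Let phi2 x := f2 (x - delta) - f2 (x + delta).
Let psi x := h (x - delta) - h (x + delta).

Let df (x : R) : is_derive x 1 f (f1 x). Proof. exact: (is_derive_stein_sol b0 C0 hC x). Qed.
Let df1 (x : R) : is_derive x 1 f1 (f2 x). Proof. exact: (is_derive_stein_sol' b0 C0 hC x). Qed.
Let f_lip : lipschitz_by (2 * b)^-1 f.
Proof. by apply: is_derive_lipschitz df _ => x; exact: (stein_sol'_bounded b0 x C0 hC). Qed.
Let b20 : 0 < b ^+ 2. Proof. by rewrite exprn_gt0. Qed.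
Let delta0 : 0 <= delta. Proof. by rewrite mulr_ge0// ltW. Qed.
Let f01 x : 0 <= f x <= 1. Proof. exact: (stein_sol_bounded b0 x C0 hC). Qed.

Let mh : measurable_fun [set: R] h.
Proof. by apply: continuous_measurable_fun; exact: lipschitz_by_continuous hC. Qed.
Let mf : measurable_fun [set: R] f.
Proof. by apply: continuous_measurable_fun; exact: lipschitz_by_continuous f_lip. Qed.

Let f2M x : `|f2 x| <= (b ^+ 2)^-1.
Proof.
rewrite normrM (ger0_norm (_ : 0 <= (b ^+ 2)^-1)) ?invr_ge0 ?(ltW b20)//.
rewrite ler_piMl ?invr_ge0 ?(ltW b20)// ler_norml.
by have := f01 x; have := h01 x; lra.
Qed.

Let dphi (x : R) : is_derive x 1 phi (phi1 x).
Proof.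
exact: (is_deriveB (is_derive_shift (- delta) x df) (is_derive_shift delta x df)).
Qed.

Let dphi1 (x : R) : is_derive x 1 phi1 (phi2 x).
Proof.
exact: (is_deriveB (is_derive_shift (- delta) x df1) (is_derive_shift delta x df1)).
Qed.

Let phi_le x : `|phi x| <= delta / b.
Proof.
apply: (le_trans (f_lip _ _)).
have -> : x - delta - (x + delta) = - (2 * delta) by ring.
have d2 : 0 <= 2 * delta by apply: mulr_ge0.
by rewrite normrN (ger0_norm d2) invfM mulrACA mulVf// mul1r mulrC.
Qed.

Let m_shift (u : R -> R) (c : R) : measurable_fun [set: R] u ->
  measurable_fun [set: R] (fun x => u (x + c)).
Proof. by move=> mu; apply: (measurableT_comp mu); exact: measurable_funD. Qed.

Let m_aff (u : R -> R) (s : R) : measurable_fun [set: R] u ->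
  measurable_fun [set: R] (fun x => u (k * (s + x))).
Proof.
move=> mu; apply: (measurableT_comp mu).
by apply: measurable_funM => //; exact: measurable_funD.
Qed.

Let mphi : measurable_fun [set: R] phi.
Proof. by apply: measurable_funB; exact: m_shift. Qed.
Let mf2 : measurable_fun [set: R] f2.
Proof. by apply: measurable_funM => //; exact: measurable_funB. Qed.
Let mphi2 : measurable_fun [set: R] phi2.
Proof. by apply: measurable_funB; exact: m_shift. Qed.
Let mpsi : measurable_fun [set: R] psi.
Proof. by apply: measurable_funB; exact: m_shift. Qed.

(** Of the factor 3 / 2 of delta / b, 1 / 2 is the increment of [f] under the coupling and 1 bounds
    the mean of [phi] under [L j]. The increment of [phi] stays signed, so that [abel_geometric] can
    sum it over j. *)
Lemma kolmogorov_step j s :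
  `|\int[P]_v ((1 - p) * f (k * (s + X j v)) + p * h (k * (s + X j v))) - f (k * s)|
    <= p * (3 * delta / (2 * b)) - (\int[P]_v phi (k * (s + X j v)) - phi (k * s)).
Proof.
have iP (u : R -> R) (M' : R) : measurable_fun [set: R] u -> (forall x, `|u x| <= M') ->
    P.-integrable [set: T] (EFin \o (fun v => u (k * (s + X j v)))).
  move=> mu uM; apply: (@integrable_bounded _ _ _ _ _ M') => [|v]; last exact: uM.
  exact: (measurableT_comp (m_aff s mu)).
have iL (u : R -> R) (M' : R) : measurable_fun [set: R] u -> (forall x, `|u x| <= M') ->
    (L j).-integrable [set: R] (EFin \o (fun v => u (k * (s + v)))).
  move=> mu uM; apply: (@integrable_bounded _ _ _ _ _ M') => [|v]; last exact: uM.
  exact: m_aff.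
have f1' x : `|f x| <= 1 by rewrite ger0_norm; case/andP: (f01 x).
have fh1 x : `|f x - h x| <= 1 by rewrite ler_norml; have := f01 x; have := h01 x; lra.
have mfh : measurable_fun [set: R] (fun x => f x - h x) by exact: measurable_funB.
have psi1 x : `|psi x| <= 1.
  by rewrite ler_norml /psi; have := h01 (x - delta); have := h01 (x + delta); lra.
have phi2M x : `|phi2 x| <= 2 * (b ^+ 2)^-1.
  by apply: (le_trans (ler_normB _ _)); have := f2M (x - delta); have := f2M (x + delta); lra.
(* Since b^2 f'' = f - h, the increment of [f] is p times a mean of f - h under [L j]. With [e3],
   the whole step becomes p times the difference of the means of f - h under the two laws. *)
have e1 : \int[P]_v f (k * (s + X j v)) - f (k * s) =
    p * \int[L j]_x (f (k * (s + x)) - h (k * (s + x))).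
  rewrite (@equilibrium_shift j (L j) s f f1 f2 (1 + (b ^+ 2)^-1) (@eqL j) df df1)//; last 2 first.
  - by move=> x; rewrite (le_trans (f1' x))// lerDl invr_ge0 ltW.
  - by move=> x; rewrite (le_trans (f2M x))// lerDr.
  rewrite -mulrA -RintegralZl//; last exact: (iL _ _ mf2 f2M).
  congr (_ * _); apply: eq_Rintegral => x _; rewrite /f2.
  by rewrite mulrCA mulfV ?mulr1// gt_eqF.
have e2 : \int[P]_v phi (k * (s + X j v)) - phi (k * s) =
    p * b ^+ 2 * \int[L j]_x phi2 (k * (s + x)).
  apply: (@equilibrium_shift j (L j) s phi phi1 phi2 (delta / b + 2 * (b ^+ 2)^-1)
    (@eqL j) dphi dphi1) => // x.
  - by rewrite (le_trans (phi_le x))// lerDl mulr_ge0// invr_ge0 ltW.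
  - by rewrite (le_trans (phi2M x))// lerDr divr_ge0// ltW.
(* The mean of [psi] left by the coupling is rewritten through [phi] and [phi2]; by [e2] the part
   with [phi2] returns to an increment of [phi] under [P]. *)
have psiE : b ^+ 2 * \int[L j]_x phi2 (k * (s + x)) =
    \int[L j]_x phi (k * (s + x)) - \int[L j]_x psi (k * (s + x)).
  rewrite -RintegralZl//; last exact: (iL _ _ mphi2 phi2M).
  rewrite -RintegralB//; [|exact: (iL _ _ mphi phi_le)|exact: (iL _ _ mpsi psi1)].
  apply: eq_Rintegral => x _; rewrite /phi2 /f2 /phi /psi.
  by field; rewrite gt_eqF.
have philL : \int[L j]_x phi (k * (s + x)) <= delta / b.
  rewrite -[leRHS](Rintegral_prob_cst (L j)); apply: le_Rintegral => //.
  - exact: (iL _ _ mphi phi_le).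
  - exact: finite_measure_integrable_cst.
  - by move=> x _; rewrite (le_trans (ler_norm _)).
have e3 : \int[P]_v ((1 - p) * f (k * (s + X j v)) + p * h (k * (s + X j v))) =
    \int[P]_v f (k * (s + X j v)) - p * \int[P]_v (f (k * (s + X j v)) - h (k * (s + X j v))).
  rewrite -RintegralZl//; last exact: (iP _ _ mfh fh1).
  rewrite -RintegralB//; last 2 first.
  - exact: (iP _ _ mf f1').
  - exact: (integrableZl measurableT p (iP _ _ mfh fh1)).
  by apply: eq_Rintegral => v _; ring.
have cpl : `|\int[P]_v (f (k * (s + X j v)) - h (k * (s + X j v))) -
    \int[L j]_x (f (k * (s + x)) - h (k * (s + x)))| <=
    \int[L j]_x (delta / (2 * b) + psi (k * (s + x))).
  apply: (@quantile_coupling _ _ _ _ (X j) (L j) B (delta / (2 * b) + 1)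
     (fun x => f (k * (s + x)) - h (k * (s + x))) (fun x => delta / (2 * b) + psi (k * (s + x)))).
  - exact: QB.
  - exact: (m_aff s mfh).
  - by apply: measurable_funD => //; exact: (m_aff s mpsi).
  - by move=> x; rewrite (le_trans (fh1 _))// lerDr divr_ge0// mulr_ge0// ltW.
  - move=> x; rewrite (le_trans (ler_normD _ _))// lerD//.
    by rewrite ger0_norm// divr_ge0// mulr_ge0// ltW.
  - move=> x y xy.
    have kxy : `|k * (s + x) - k * (s + y)| <= delta.
      have -> : k * (s + x) - k * (s + y) = k * (x - y) by ring.
      by rewrite normrM (gtr0_norm k0) ler_wpM2l// ltW.
    move: kxy; move: (k * (s + x)) (k * (s + y)) => u v uv.
    have -> : f u - h u - (f v - h v) = (f u - f v) - (h u - h v) by ring.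
    apply: (le_trans (ler_normB _ _)); apply: lerD.
      by apply: (le_trans (f_lip _ _)); rewrite mulrC ler_wpM2r// invr_ge0 mulr_ge0// ltW.
    move: uv; rewrite ler_norml => /andP[uv1 uv2].
    (* Monotonicity places h u and h v between h (v + delta) and h (v - delta), whatever the order
       of u and v. *)
    have g1 : h u <= h (v - delta) by apply: h_ni; lra.
    have g2 : h (v + delta) <= h u by apply: h_ni; lra.
    have g3 : h v <= h (v - delta) by apply: h_ni; lra.
    have g4 : h (v + delta) <= h v by apply: h_ni; lra.
    by rewrite /psi ler_norml; lra.
have cE : \int[L j]_x (delta / (2 * b) + psi (k * (s + x))) =
    delta / (2 * b) + \int[L j]_x psi (k * (s + x)).
  rewrite RintegralD//; last exact: (iL _ _ mpsi psi1).
  - by rewrite Rintegral_prob_cst.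
  - exact: finite_measure_integrable_cst.
rewrite cE in cpl.
rewrite e3 e2.
have -> : \int[P]_v f (k * (s + X j v)) -
    p * \int[P]_v (f (k * (s + X j v)) - h (k * (s + X j v))) - f (k * s) =
  - (p * (\int[P]_v (f (k * (s + X j v)) - h (k * (s + X j v))) -
    \int[L j]_x (f (k * (s + x)) - h (k * (s + x))))).
  by rewrite mulrBr -e1; ring.
rewrite normrN normrM (gtr0_norm p0) -[X in _ <= _ - X]mulrA psiE -mulrBr ler_pM2l//.
apply: (le_trans cpl).
have -> : 3 * delta / (2 * b) = delta / (2 * b) + delta / b.
  by have := gt_eqF b0; move: b delta => b' d' /negbT b'0; field.
by move: philL; lra.
Qed.

Lemma kolmogorov_test :
  `|\int[P]_w h (k * rsum X N w) - f 0| <= 7 * delta / (2 * b).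
Proof.
have lf := lipschitz_linear_growth f_lip; have lh := lipschitz_linear_growth hC.
have D0 : 0 <= delta / b by rewrite divr_ge0// ltW.
pose A j := \int[P]_w phi (k * psum X j w).
have AD j : `|A j| <= delta / b.
  have ip : P.-integrable [set: T] (EFin \o (fun w => phi (k * psum X j w))).
    apply: (@integrable_bounded _ _ _ _ _ (delta / b)) => [|w]; last exact: phi_le.
    by apply: (measurableT_comp mphi); apply: measurable_funM => //; exact: measurable_psum.
  apply: (le_trans (le_normr_Rintegral _ ip)) => //.
  rewrite -[leRHS](Rintegral_prob_cst P); apply: le_Rintegral => //.
  - exact: integrable_abse ip.
  - exact: finite_measure_integrable_cst.
pose r j := p^-1 * \int[P]_w
  (\int[P]_v ((1 - p) * f (k * (psum X j w + X j v)) + p * h (k * (psum X j w + X j v))) -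
   f (k * psum X j w)).
have rA j : `|r j| <= 3 * delta / (2 * b) - p^-1 * (A j.+1 - A j).
  rewrite /r normrM ger0_norm ?invr_ge0 ?(ltW p0)// ler_pdivrMl// mulrBr mulVKf ?gt_eqF//.
  have [i1 _] := stein_step mf mh lf lh j.
  have mphik : measurable_fun [set: R] (fun x => phi (k * x)).
    by apply: (measurableT_comp mphi); exact: measurable_funM.
  have lphik : linear_growth (fun x => phi (k * x)).
    by apply: (@bounded_linear_growth (delta / b)) => x; exact: phi_le.
  have [i2 e2] := Rintegral_psumS mN indX integrable_X j mphik lphik.
  have i3 : P.-integrable [set: T] (EFin \o (fun w => phi (k * psum X j w))).
    exact: (integrable_linear_growth mphik lphik (integrable_psum integrable_X j)).
  have i4 := integrableB measurableT i2 i3.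
  have iC := finite_measure_integrable_cst P (p * (3 * delta / (2 * b))) measurableT.
  apply: (le_trans (le_normr_Rintegral _ i1)) => //.
  apply: (@le_trans _ _ (\int[P]_w (p * (3 * delta / (2 * b)) -
     (\int[P]_v phi (k * (psum X j w + X j v)) - phi (k * psum X j w))))).
    apply: le_Rintegral => //; first exact: integrable_abse i1.
      exact: (integrableB measurableT iC i4).
    by move=> w _; exact: kolmogorov_step.
  by rewrite RintegralB// Rintegral_prob_cst RintegralB// -e2.
apply: (stein_limit mf mh lf lh (r := r)).
- by move=> j; rewrite /r mulrA mulfV ?mul1r// gt_eqF.
- apply/norm_cvg0P.
  apply: (@squeeze_cvgr _ _ _ _ (cst 0) (fun n => (1 - p) ^+ n)).
  + apply: nearW => n /=; rewrite normr_ge0/= normrM ger0_norm ?exprn_ge0 ?(ltW q0)//.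
    rewrite ler_piMr ?exprn_ge0 ?(ltW q0)//.
    have ip : P.-integrable [set: T] (EFin \o (fun w => f (k * psum X n w))).
      apply: (@integrable_bounded _ _ _ _ _ 1) => [|w].
        by apply: (measurableT_comp mf); apply: measurable_funM => //; exact: measurable_psum.
      by rewrite ger0_norm; case/andP: (f01 (k * psum X n w)).
    apply: (le_trans (le_normr_Rintegral _ ip)) => //.
    rewrite -[leRHS](Rintegral_prob_cst P); apply: le_Rintegral => //.
    * exact: integrable_abse ip.
    * exact: finite_measure_integrable_cst.
    * by move=> w _; rewrite ger0_norm; case/andP: (f01 (k * psum X n w)).
  + exact: cvg_cst.
  + by apply: cvg_expr; rewrite ger0_norm ?(ltW q0).
- move=> n; apply: (le_trans (ler_norm_sum _ _ _)).
  apply: (@le_trans _ _ (\sum_(j < n) (p * (1 - p) ^+ j * (3 * delta / (2 * b)) -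
      (1 - p) ^+ j * (A j.+1 - A j)))).
    apply: ler_sum => j _.
    have pq0 : 0 <= p * (1 - p) ^+ j by rewrite mulr_ge0 ?exprn_ge0 ?(ltW p0) ?(ltW q0).
    rewrite normrM (ger0_norm pq0) (le_trans (ler_wpM2l pq0 (rA j)))//.
    by rewrite mulrBr lerD2l lerN2 mulrA (mulrAC p) mulfV ?gt_eqF// mul1r.
  rewrite sumrB -mulr_suml sum_geometric.
  have h1 : (1 - (1 - p) ^+ n) * (3 * delta / (2 * b)) <= 3 * delta / (2 * b).
    apply: ler_piMl; last by rewrite gerBl exprn_ge0// ltW.
    by apply: divr_ge0; apply: mulr_ge0 => //; exact: ltW.
  have h2 := @abel_geometric A (delta / b) n AD.
  (* 3 / 2 comes from the single steps, 2 from the summation by parts. *)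
  have -> : 7 * delta / (2 * b) = 3 * delta / (2 * b) + 2 * (delta / b).
    by have := gt_eqF b0; move: b delta => b' d' /negbT b'0; field.
  exact: lerD.
- apply: (@integrable_bounded _ _ _ _ _ 1) => [|w].
    apply: (measurableT_comp mh); apply: measurable_funM => //.
    exact: measurable_rsum mN.
  by rewrite ger0_norm; case/andP: (h01 (k * rsum X N w)).
Qed.

End kolmogorov.

Lemma dW_laplace_le :
  let rho := ereal_sup (range (fun i => 'E_P[fun w => (`|X i w| ^+ 3)%R])) in
  (rho < +oo)%E ->
  (dW_laplace P (random_sum (fun i => (X i : T -> R)) N p) b <=
    (12 * Num.sqrt p)%:E * (sigma%:E + rho * ((3 * sigma ^+ 2)^-1)%:E))%E.
Proof.
move=> rho rhoy.
have X3le i : ('E_P[fun w => (`|X i w| ^+ 3)%R] <= rho)%E.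
  by apply: ereal_sup_ubound; exists i.
have X30 i : (0 <= 'E_P[fun w => (`|X i w| ^+ 3)%R])%E.
  by apply: expectation_ge0 => w; rewrite exprn_ge0.
have rho0 : (0 <= rho)%E by apply: le_trans (X3le 0%N).
have rhof : rho \is a fin_num by rewrite ge0_fin_numE.
have iX3 i : P.-integrable [set: T] (EFin \o (fun w => `|X i w| ^+ 3)).
  apply/integrableP; split.
    by apply/measurable_EFinP; apply: measurable_funX; exact: measurableT_comp.
  apply: le_lt_trans rhoy; apply: le_trans (X3le i); rewrite unlock.
  by rewrite le_eqVlt; apply/orP; left; apply/eqP; apply: eq_integral => w _ /=;
    rewrite ger0_norm// exprn_ge0.
have X3 i : \int[P]_w (`|X i w| ^+ 3) <= fine rho.
  apply: fine_le => //; first exact: (integrable_fin_num _ (iX3 i)).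
  by have := X3le i; rewrite unlock.
have -> : ((12 * Num.sqrt p)%:E * (sigma%:E + rho * ((3 * sigma ^+ 2)^-1)%:E) =
    (12 * Num.sqrt p * (sigma + fine rho * (3 * sigma ^+ 2)^-1))%:E)%E.
  rewrite [RHS]EFinM; congr (_ * _)%E; rewrite [RHS]EFinD; congr (_ + _)%E.
  by rewrite [RHS]EFinM fineK.
apply: ge_ereal_sup => _ [h h1 <-].
have {}h1 : lipschitz_by 1 h by move=> x y; rewrite mul1r.
have mh : measurable_fun [set: R] h.
  by apply: continuous_measurable_fun; exact: lipschitz_by_continuous h1.
have ih : P.-integrable [set: T] (EFin \o (h \o (fun w => k * rsum X N w))).
  have ir := integrable_rsum mN indX integrable_X p01 pN Rintegral_normX.
  exact: (@integrable_linear_growth _ _ _ _ (fun w => k * rsum X N w) _ mh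
    (lipschitz_linear_growth h1) (integrableZl measurableT k ir)).
have -> : 'E_P[h \o random_sum (fun i => (X i : T -> R)) N p] = (\int[P]_w h (k * rsum X N w))%:E.
  rewrite unlock /Rintegral fineK//; exact: (integrable_fin_num _ ih).
rewrite (laplace_expect_stein_sol b0 ler01 h1) -EFinB lee_fin.
apply: (le_trans (wasserstein_test h1 iX3 X3)).
have s2 : sigma ^+ 2 != 0 by rewrite gt_eqF// exprn_gt0.
have fr0 : 0 <= fine rho by rewrite fine_ge0.
(* The bound obtained is sqrt p (4 rho / sigma^2 + 2 sigma). The coefficient of rho is exactly 12 /
   3, while that of sigma has room: 2 against 12. *)
have -> : k * (2 / b ^+ 2) * (fine rho + b ^+ 2 * sigma) =
    k * (4 * fine rho / sigma ^+ 2 + 2 * sigma).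
  by rewrite bb; move: s2; move: (sigma ^+ 2) => s' s'0; field.
have -> : 12 * Num.sqrt p * (sigma + fine rho / (3 * sigma ^+ 2)) =
    k * (4 * fine rho / sigma ^+ 2 + 12 * sigma).
  by rewrite -/k; move: s2; move: (sigma ^+ 2) => s' s'0; field.
by rewrite ler_pM2l// lerD2l ler_pM2r// ler_nat.
Qed.

End geometric_sum.

(** * From ramps to distribution functions *)

Section ramp.
Context {R : realType}.
Variables x e : R.
Hypothesis e0 : 0 < e.

(** A smoothed indicator of []-oo, x]], falling from 1 to 0 across [[x, x + e]]. *)
Definition ramp (y : R) : R := Num.max 0 (Num.min 1 ((x + e - y) / e)).

Lemma ramp01 y : 0 <= ramp y <= 1.
Proof. by rewrite le_max lexx/= ge_max ler01 ge_min lexx. Qed.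

Lemma ramp_nonincreasing y z : y <= z -> ramp z <= ramp y.
Proof.
move=> yz; rewrite /ramp; apply: le_max2 => //; apply: le_min2 => //.
by rewrite ler_pM2r ?invr_gt0// lerD2l lerN2.
Qed.

Lemma ramp_eq1 y : y <= x -> ramp y = 1.
Proof.
move=> yx; rewrite /ramp.
have h : 1 <= (x + e - y) / e by rewrite ler_pdivlMr// mul1r; lra.
by rewrite (min_idPl h); apply/max_idPr.
Qed.

Lemma ramp_eq0 y : x + e <= y -> ramp y = 0.
Proof.
move=> yx; rewrite /ramp.
have h : (x + e - y) / e <= 0 by rewrite ler_pdivrMr// mul0r; lra.
by apply/max_idPl; rewrite ge_min h orbT.
Qed.

Lemma ramp_lipschitz : lipschitz_by e^-1 ramp.
Proof.
have clamp (u v : R) : `|Num.max 0 (Num.min 1 u) - Num.max 0 (Num.min 1 v)| <= `|u - v|.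
  wlog uv : u v / u <= v.
    move=> H; have [/H//|/ltW/H] := leP u v.
    by rewrite distrC (distrC v u).
  rewrite [leRHS]distrC [leLHS]distrC [leRHS]ger0_norm ?subr_ge0//.
  rewrite ger0_norm.
    by rewrite /Num.max /Num.min; repeat case: ifPn; rewrite -?leNgt; lra.
  by rewrite subr_ge0; apply: le_max2 => //; apply: le_min2.
move=> y z; apply: (le_trans (clamp _ _)).
have -> : (x + e - y) / e - (x + e - z) / e = - (e^-1 * (y - z)) by ring.
by rewrite normrN normrM ger0_norm// invr_ge0 ltW.
Qed.

End ramp.

Section laplace_cdf.
Context {R : realType}.
Variable b : R.
Hypothesis b0 : 0 < b.
Notation mu := (@lebesgue_measure R).

Lemma laplace_pdf_ge0 y : 0 <= laplace_pdf b y.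
Proof. by rewrite mulr_ge0 ?expR_ge0// invr_ge0 mulr_ge0// ltW. Qed.

Lemma laplace_pdf_le y : laplace_pdf b y <= (2 * b)^-1.
Proof.
rewrite ler_piMr ?invr_ge0 ?mulr_ge0 ?(ltW b0)// -expR0 ler_expR oppr_le0.
by rewrite divr_ge0// ltW.
Qed.

Let mpdf (D : set (measurableTypeR R)) : measurable D ->
  measurable_fun D (fun y => (laplace_pdf b y)%:E).
Proof.
by move=> mD; apply/measurable_EFinP/measurable_funTS; exact: measurable_laplace_pdf.
Qed.

(** The price of smoothing at width [e]: the Laplace density is at most 1 / (2 b). *)
Lemma laplace_cdf_step (x e : R) : 0 < e ->
  (laplace_cdf b (x + e) <= laplace_cdf b x + (e / (2 * b))%:E)%E.
Proof.
move=> e0; rewrite /laplace_cdf.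
have -> : `]-oo, (x + e)%R]%classic = `]-oo, x] `|` `]x, (x + e)%R].
  by rewrite -itv_bndbnd_setU// bnd_simp ltW// ltrDl.
rewrite ge0_integral_setU//; last 3 first.
- by apply: mpdf; exact: measurableU.
- by move=> y _; rewrite lee_fin laplace_pdf_ge0.
- apply/disj_setPS => y /=; rewrite !in_itv/= => -[yx /andP[xy _]]; lra.
rewrite leeD2l//.
apply: (@le_trans _ _ (\int[mu]_(y in `]x, (x + e)%R]) ((2 * b)^-1)%:E)%E).
  apply: ge0_le_integral => //.
  - by move=> y _; rewrite lee_fin laplace_pdf_ge0.
  - exact: mpdf.
  - by move=> y _; rewrite lee_fin laplace_pdf_le.
rewrite integral_cst//= lebesgue_measure_itv/= lte_fin ltrDl e0.
by rewrite -EFinD -EFinM lee_fin addrAC subrr add0r mulrC.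
Qed.

Lemma laplace_cdf_ramp (x e : R) : 0 < e ->
  (laplace_cdf b x <= laplace_expect b (ramp x e) <= laplace_cdf b (x + e))%E.
Proof.
move=> e0; have mr : measurable_fun [set: R] (ramp x e).
  by apply: continuous_measurable_fun; exact: lipschitz_by_continuous (ramp_lipschitz x e0).
have mrp : measurable_fun [set: measurableTypeR R] (fun y => (ramp x e y * laplace_pdf b y)%:E).
  by apply/measurable_EFinP/measurable_funM => //; exact: measurable_laplace_pdf.
have r0 y : (0 <= (ramp x e y * laplace_pdf b y)%:E)%E.
  by rewrite lee_fin mulr_ge0 ?laplace_pdf_ge0//; case/andP: (ramp01 x e y).
have mI (z : R) : @measurable _ (measurableTypeR R) `]-oo, z] by [].
rewrite /laplace_cdf /laplace_expect; apply/andP; split.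
- rewrite integral_mkcond; apply: ge0_le_integral => //.
  + by move=> y _; rewrite patchE; case: ifPn => //; rewrite lee_fin laplace_pdf_ge0.
  + by apply/(measurable_restrictT _ (mI _)); exact: mpdf.
  + move=> y _; rewrite patchE; case: ifPn => // /set_mem /=.
    by rewrite in_itv/= => yx; rewrite ramp_eq1// mul1r.
- rewrite [leRHS]integral_mkcond; apply: ge0_le_integral => //.
  + by apply/(measurable_restrictT _ (mI _)); exact: mpdf.
  + move=> y _; rewrite patchE; case: ifPn => [_|/negP].
      rewrite lee_fin ler_piMl ?laplace_pdf_ge0//; by case/andP: (ramp01 x e y).
    rewrite inE/= in_itv/= => /negP; rewrite -ltNge => /ltW yx.
    by rewrite ramp_eq0// mul0r.
Qed.

End laplace_cdf.

Lemma dK_laplace_le d (T : measurableType d) (R : realType) (P : probability T R)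
    (X : nat -> {RV P >-> R}) (sigma p : R) (N : T -> nat) (L : nat -> probability R R) :
  0 < sigma -> 0 < p < 1 ->
  (forall i, 'E_P[fun w => (X i w ^+ 2)%R] = (sigma ^+ 2)%:E) ->
  geometric_rv P N p ->
  mutually_independent P
    (fun o : option nat => match o with
                           | None => fun w => (N w)%:R
                           | Some i => (X i : T -> R) end) ->
  (forall i, equilibrium_law P (X i) (L i)) ->
  (dK_laplace P (random_sum (fun i => (X i : T -> R)) N p) (sigma / Num.sqrt 2) <=
     (1704 / 100 * Num.sqrt p / sigma)%:E *
     ereal_sup [set e | exists (i : nat) (u : R), (0 < u < 1)%R /\
       e = (`|gen_inv (cdf_rv P (X i)) u - gen_inv (cdf_law (L i)) u|)%:E])%E.
Proof.
move=> sigma0 p01 EX2 geoN indX eqL.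
(* The argument produces the constant 4 sqrt 2, which is below 6. *)
have : 6 <= 1704 / 100 :> R by lra.
move: (1704 / 100) => cc cc6.
set S := [set e | _]; set W := random_sum _ _ _; set b := sigma / _.
pose k := Num.sqrt p.
have p0 : 0 < p by case/andP: p01.
have k0 : 0 < k by rewrite sqrtr_gt0.
have b0 : 0 < b by rewrite divr_gt0// sqrtr_gt0.
pose c := cc * k / sigma.
have c0 : 0 < c by rewrite divr_gt0// mulr_gt0// (lt_le_trans _ cc6).
have mW : measurable_fun [set: T] W.
  by apply: measurable_funM => //; exact: (measurable_rsum X geoN.1).
have mA x : measurable [set w | W w <= x].
  rewrite (_ : [set _ | _] = W @^-1` `]-oo, x]).
    by rewrite -[X in measurable X]setTI; exact: mW.
  by apply/seteqP; split => w /=; rewrite in_itv.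
(* The ramp width k B must be positive, whereas the supremum may be 0. Hence an arbitrary positive
   [B] above the supremum, brought down to it at the end. *)
have main (B : R) : 0 < B -> (ereal_sup S <= B%:E)%E -> (dK_laplace P W b <= (c * B)%:E)%E.
  move=> B0 SB.
  have QB i u : 0 < u < 1 ->
      `|gen_inv (cdf_rv P (X i)) u - gen_inv (cdf_law (L i)) u| <= B.
    move=> u01; rewrite -lee_fin; apply: le_trans SB; apply: ereal_sup_ubound.
    by exists i, u.
  pose e := k * B.
  have e0 : 0 < e by exact: mulr_gt0.
  have ei0 : 0 <= e^-1 by rewrite invr_ge0 ltW.
  pose I x := \int[P]_w ramp x e (W w).
  pose f0 x := stein_sol b (ramp x e) 0.
  have key x : `|I x - f0 x| <= 7 * e / (2 * b).
    exact: (kolmogorov_test sigma0 p01 EX2 geoN indX eqL (ltW B0) QB ei0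
      (ramp_lipschitz x e0) (ramp01 x e) (@ramp_nonincreasing _ x e e0)).
  have iramp x : P.-integrable [set: T] (EFin \o (fun w => ramp x e (W w))).
    apply: (@integrable_bounded _ _ _ _ _ 1) => [|w].
      apply: measurableT_comp => //; apply: continuous_measurable_fun.
      exact: lipschitz_by_continuous (ramp_lipschitz x e0).
    by rewrite ger0_norm; case/andP: (ramp01 x e (W w)).
  have iind x : P.-integrable [set: T] (EFin \o \1_[set w | W w <= x]).
    by apply: (@integrable_bounded _ _ _ _ _ 1) => [|w]; rewrite ?indicE ?normr_nat ?lern1 ?leq_b1.
  pose G x := fine (P [set w | W w <= x]).
  have GE x : G x = \int[P]_w \1_[set w | W w <= x] w.
    by rewrite /G /Rintegral integral_indic// setIT.
  have GI x : G x <= I x.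
    rewrite GE; apply: le_Rintegral => // w _; rewrite indicE.
    case: (boolP (w \in _)) => [/set_mem/= Wx|_]; first by rewrite ramp_eq1.
    by case/andP: (ramp01 x e (W w)).
  have IG x : I x <= G (x + e).
    rewrite GE; apply: le_Rintegral => // w _; rewrite indicE.
    case: (boolP (w \in _)) => [_|/negP]; first by case/andP: (ramp01 x e (W w)).
    by rewrite inE/= => /negP; rewrite -ltNge => /ltW Wx; rewrite ramp_eq0.
  pose F x := fine (laplace_cdf b x).
  have lE x : laplace_expect b (ramp x e) = (f0 x)%:E.
    exact: (laplace_expect_stein_sol b0 ei0 (ramp_lipschitz x e0)).
  have FE x : laplace_cdf b x = (F x)%:E.
    rewrite /F fineK// ge0_fin_numE.
      have /andP[+ _] := laplace_cdf_ramp b0 x e0.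
      by rewrite lE => /le_lt_trans; apply; exact: ltry.
    by apply: integral_ge0 => y _; rewrite lee_fin laplace_pdf_ge0.
  have Ff x : F x <= f0 x.
    by have /andP[+ _] := laplace_cdf_ramp b0 x e0; rewrite lE FE lee_fin.
  have fF x : f0 x <= F (x + e).
    by have /andP[_] := laplace_cdf_ramp b0 x e0; rewrite lE FE lee_fin.
  have FF x : F (x + e) <= F x + e / (2 * b).
    by have := laplace_cdf_step b0 x e0; rewrite !FE -EFinD lee_fin.
  apply: ge_ereal_sup => _ [x _ <-].
  have -> : P [set w | W w <= x] = (G x)%:E by rewrite /G fineK// fin_num_measure.
  rewrite FE -EFinB lee_fin.
  have bnd : 4 * (e / b) <= c * B.
    have s2 : Num.sqrt 2 <= 3 / 2 :> R.
      rewrite -[leRHS]ger0_norm// -sqrtr_sqr ler_sqrt; lra.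
    have -> : 4 * (e / b) = 4 * Num.sqrt 2 * (k / sigma * B).
      have r20 : Num.sqrt 2 != 0 :> R by rewrite gt_eqF// sqrtr_gt0.
      have sn0 : sigma != 0 by rewrite gt_eqF.
      rewrite /e /b; move: r20; move: (Num.sqrt 2) => r2 r20; field.
      by rewrite r20 sn0.
    have -> : c * B = cc * (k / sigma * B) by rewrite /c; ring.
    have kB : 0 <= k / sigma * B.
      by apply: mulr_ge0 (ltW B0); exact: divr_ge0 (ltW k0) (ltW sigma0).
    by apply: ler_wpM2r => //; move: s2 cc6; lra.
  apply: le_trans bnd.
  (* 7 / 2 is the error for a ramp and 1 / 2 the smoothing. The ramp at x bounds P (W <= x) from
     above, the ramp at x - e from below. *)
  have -> : 4 * (e / b) = 7 * e / (2 * b) + e / (2 * b) by field; rewrite gt_eqF.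
  move: (key x) (key (x - e)); rewrite !ler_norml.
  have := GI x; have := IG (x - e); have := Ff (x - e); have := fF x.
  have := FF x; have := FF (x - e); rewrite !subrK.
  move: (G x) (F x) (I x) (I (x - e)) (f0 x) (f0 (x - e)) (F (x - e)) (F (x + e)).
  move: (7 * e / (2 * b)) (e / (2 * b)) => a1 a2 *; lra.
have S0 : (0 <= ereal_sup S)%E.
  apply: (@le_trans _ _ (`|gen_inv (cdf_rv P (X 0%N)) 2^-1 - gen_inv (cdf_law (L 0%N)) 2^-1|)%:E).
    by rewrite lee_fin.
  by apply: ereal_sup_ubound; exists 0%N, 2^-1; split => //; lra.
have [Sy|Sy] := eqVneq (ereal_sup S) +oo%E.
  by rewrite Sy gt0_muley ?lte_fin// leey.
have Sf : ereal_sup S \is a fin_num by rewrite ge0_fin_numE// ltey.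
rewrite -(fineK Sf) -EFinM; apply/lee_addgt0Pr => e e0.
have f0 : 0 <= fine (ereal_sup S) by rewrite fine_ge0.
apply: (le_trans (main (fine (ereal_sup S) + e / c) _ _)).
- by rewrite ltr_wpDl// divr_gt0.
- by rewrite -[leLHS](fineK Sf) lee_fin lerDl ltW// divr_gt0.
- by rewrite -EFinD lee_fin mulrDr (mulrC c (e / c)) divfK// gt_eqF.
Qed.

(** * Lower bound *)

Section sin_cos_bounds.
Context {R : realType}.
Implicit Types x : R.

(** Drives the chain [s1], [c2], [s3], [c4], [s5]: all these functions vanish at 0 and each is the
    derivative of the next, starting from cos <= 1. *)
Lemma ge0_of_derive_ge0 (g dg : R -> R) x :
  (forall y : R, is_derive y 1 g (dg y)) -> g 0 = 0 ->
  (forall y, 0 <= y -> 0 <= dg y) -> 0 <= x -> 0 <= g x.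
Proof.
move=> gd g0 dg0 x0.
have [|z] := @MVT_segment _ g dg 0 x x0 (fun z _ => gd z).
  by apply: continuous_subspaceT; exact: is_derive_continuous gd.
rewrite in_itv/= g0 !subr0 => /andP[z0 _] ->.
by rewrite mulr_ge0// dg0.
Qed.

Let s1 x : 0 <= x -> 0 <= x - sin x.
Proof.
apply: (@ge0_of_derive_ge0 (fun x => x - sin x) (fun x => 1 - cos x)).
- by rewrite sin0 subr0.
- by move=> y _; rewrite subr_ge0 cos_le1.
Qed.

Let c2 x : 0 <= x -> 0 <= cos x - 1 + 2^-1 * x ^+ 2.
Proof.
apply: (@ge0_of_derive_ge0 (fun x => cos x - 1 + 2^-1 * x ^+ 2) (fun x => x - sin x)).
- by move=> y; apply: is_derive_eq; rewrite /GRing.scale/=; field.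
- by rewrite cos0 subrr expr0n/= mulr0 addr0.
- exact: s1.
Qed.

Let s3 x : 0 <= x -> 0 <= sin x - x + 6^-1 * x ^+ 3.
Proof.
apply: (@ge0_of_derive_ge0 (fun x => sin x - x + 6^-1 * x ^+ 3)
  (fun x => cos x - 1 + 2^-1 * x ^+ 2)).
- by move=> y; apply: is_derive_eq; rewrite /GRing.scale/=; field.
- by rewrite sin0 subrr expr0n/= mulr0 addr0.
- exact: c2.
Qed.

Let c4 x : 0 <= x -> 0 <= 1 - 2^-1 * x ^+ 2 + 24^-1 * x ^+ 4 - cos x.
Proof.
apply: (@ge0_of_derive_ge0 (fun x => 1 - 2^-1 * x ^+ 2 + 24^-1 * x ^+ 4 - cos x)
  (fun x => sin x - x + 6^-1 * x ^+ 3)).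
- by move=> y; apply: is_derive_eq; rewrite /GRing.scale/=; field.
- by rewrite cos0 !expr0n/= !mulr0 subr0 addr0 subrr.
- exact: s3.
Qed.

Let s5 x : 0 <= x -> 0 <= x - 6^-1 * x ^+ 3 + 120^-1 * x ^+ 5 - sin x.
Proof.
apply: (@ge0_of_derive_ge0 (fun x => x - 6^-1 * x ^+ 3 + 120^-1 * x ^+ 5 - sin x)
  (fun x => 1 - 2^-1 * x ^+ 2 + 24^-1 * x ^+ 4 - cos x)).
- by move=> y; apply: is_derive_eq; rewrite /GRing.scale/=; field.
- by rewrite sin0 !expr0n/= !mulr0 subr0 addr0 subrr.
- exact: c4.
Qed.

Lemma cos_ge_quadratic x : 1 - 2^-1 * x ^+ 2 <= cos x.
Proof.
have [x0|/ltW x0] := leP 0 x; first by have := c2 x0; lra.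
by have := @c2 (- x); rewrite oppr_ge0 cosN sqrrN => /(_ x0); lra.
Qed.

Lemma sin_taylor1 x : `|sin x - x| <= 6^-1 * `|x| ^+ 3.
Proof.
wlog x0 : x / 0 <= x.
  move=> H; have [/H//|/ltW x0] := leP 0 x.
  have := H (- x); rewrite oppr_ge0 sinN normrN => /(_ x0).
  by rewrite -opprD normrN.
by rewrite (ger0_norm x0) ler_norml; have := s1 x0; have := s3 x0; have := exprn_ge0 3 x0; lra.
Qed.

Lemma sin_taylor3 x : `|sin x - x + 6^-1 * x ^+ 3| <= 120^-1 * `|x| ^+ 5.
Proof.
wlog x0 : x / 0 <= x.
  move=> H; have [/H//|/ltW x0] := leP 0 x.
  have := H (- x); rewrite oppr_ge0 sinN normrN => /(_ x0).
  have -> : - sin x - - x + 6^-1 * (- x) ^+ 3 = - (sin x - x + 6^-1 * x ^+ 3) by ring.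
  by rewrite normrN.
by rewrite (ger0_norm x0) ler_norml; have := s3 x0; have := s5 x0; have := exprn_ge0 5 x0; lra.
Qed.

Lemma sin_lipschitz : lipschitz_by 1 (@sin R).
Proof.
apply: (@is_derive_lipschitz _ 1 sin cos) => x.
exact: cos_max.
Qed.

End sin_cos_bounds.

(** Oddness of the sine against the symmetric Laplace law: the two halves cancel. With the test
    function sin, the distance is thus at least |E sin W|. *)
Lemma stein_sol_sin (R : realType) (b : R) : 0 < b -> stein_sol b sin 0 = 0.
Proof.
move=> b0; rewrite /stein_sol oppr0 /half_resolvent -mulrDr -mulrDr.
have is0 := integrable_expRM b0 0 ler01 (@sin_lipschitz R).
have -> : \int[lebesgue_measure]_(t in `]-oo, 0]) (expR (t / b) * (sin \o -%R) t) =
    - \int[lebesgue_measure]_(t in `]-oo, 0]) (expR (t / b) * sin t).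
  rewrite -mulN1r -RintegralZl//; apply: eq_Rintegral => t _ /=.
  by rewrite sinN mulN1r mulrN.
by rewrite subrr !mulr0.
Qed.

Section identically_distributed.
Context d (T : measurableType d) (R : realType) (P : probability T R).
Variables X Y : {RV P >-> R}.
Hypothesis XY : forall B : set R, measurable B -> P (X @^-1` B) = P (Y @^-1` B).

Lemma integral_identical (g : R -> \bar R) :
  (\int[distribution P X]_x g x = \int[distribution P Y]_x g x)%E.
Proof. by apply: eq_measure_integral => A mA _; exact: XY. Qed.

Lemma Rintegral_identical (g : R -> R) (M : R) : measurable_fun [set: R] g ->
  (forall x, `|g x| <= M) -> \int[P]_w g (X w) = \int[P]_w g (Y w).
Proof.
move=> mg gM; have mEg : measurable_fun [set: R] (EFin \o g) by exact/measurable_EFinP.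
have i (Z : {RV P >-> R}) : P.-integrable [set: T] ((EFin \o g) \o Z).
  by apply: (@integrable_bounded _ _ _ _ (g \o Z) M); [exact: measurableT_comp|move=> w; exact: gM].
rewrite /Rintegral; congr fine.
by have := integral_identical (EFin \o g); rewrite !integral_distribution.
Qed.

Lemma integrable_identical : P.-integrable [set: T] (EFin \o Y) ->
  P.-integrable [set: T] (EFin \o X).
Proof.
move=> /integrableP[_ iY]; apply/integrableP; split; first exact/measurable_EFinP.
have mE : measurable_fun [set: R] (fun x : R => `|x%:E|%E) by exact: measurableT_comp.
have := integral_identical (fun x => `|x%:E|%E).
by rewrite !ge0_integral_distribution// => ->.
Qed.

End identically_distributed.

(** Here [al], [ga] stand for the means of cos and sin at one scaled summand, [C], [S] for those at
    the sum. The quantity E = 1 - (1 - p) al lies between p and p D, where D = 1 + m / 2. The first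
    equation then gives C >= 1 / (2 D), its term in ga S being small, and the second gives |ga| C /
    2 <= p D |S|. The constant 48 is 12 times 2 times 2. *)
Lemma fixpoint_lower_bound (R : realFieldType) (S C al ga m M k p : R) :
  `|S| <= 1 -> `|ga| <= 6^-1 * p -> 12^-1 * (p * k * M) <= `|ga| ->
  p <= 2^-1 -> p * (m + 1) <= 2^-1 -> 0 <= m -> 0 < p -> 0 < k -> 0 <= M ->
  al <= 1 -> 1 - 2^-1 * (p * m) <= al ->
  C = p * al + (1 - p) * (al * C - ga * S) ->
  S = p * ga + (1 - p) * (al * S + ga * C) ->
  M / (48 * (1 + m / 2) ^+ 2) * k <= `|S|.
Proof.
move=> S1 ga6 gaM p2 pm m0 p0 k0 M0 al1 alge eC eS.
pose D := 1 + m / 2.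
have D0 : 0 < D by rewrite /D; lra.
pose E := 1 - (1 - p) * al.
have Ep : p <= E by rewrite /E; nra.
have E0 : 0 < E by exact: lt_le_trans Ep.
have ED : E <= p * D.
  have : (1 - p) * (1 - al) <= 1 * (2^-1 * (p * m)) by apply: ler_pM; lra.
  by rewrite /E /D; lra.
have EC : E * C = p * al - (1 - p) * (ga * S) by rewrite /E; lra.
have ES : E * S = ga * (p + (1 - p) * C) by rewrite /E; lra.
have gS : `|ga * S| <= 6^-1 * p.
  by rewrite normrM (le_trans _ ga6)// ler_piMr.
have gS' : (1 - p) * (ga * S) <= 6^-1 * p.
  apply: (le_trans (ler_norm _)); apply: le_trans gS.
  by rewrite normrM ler_piMl// ger0_norm; lra.
have EC2 : p / 2 <= E * C.
  have : p * (3 / 4) <= p * al by rewrite ler_pM2l//; lra.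
  rewrite EC; lra.
have C0 : 0 < C by rewrite -(pmulr_rgt0 _ E0); apply: lt_le_trans EC2; lra.
have DC : 2^-1 <= D * C.
  have : p / 2 <= p * (D * C) by apply: (le_trans EC2); rewrite mulrA ler_pM2r.
  by rewrite ler_pM2l.
have ESa : `|ga| * (C / 2) <= E * `|S|.
  rewrite -[X in X * `|S|](gtr0_norm E0) -normrM ES normrM ler_wpM2l//.
  have qC : C / 2 <= (1 - p) * C by rewrite mulrC ler_pM2r//; lra.
  by apply: le_trans (ler_norm _); lra.
have h1 : p * (k * M * C / 24) <= p * (D * `|S|).
  apply: (@le_trans _ _ (`|ga| * (C / 2))).
    have -> : p * (k * M * C / 24) = 12^-1 * (p * k * M) * (C / 2) by field.
    by rewrite ler_pM2r// divr_gt0.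
  by apply: (le_trans ESa); rewrite mulrA ler_wpM2r.
rewrite ler_pM2l// in h1.
have kM : 0 <= k * M by rewrite mulr_ge0// ltW.
rewrite -/D mulrAC ler_pdivrMr ?mulr_gt0 ?exprn_gt0//.
have h2 : k * M * (D * C) / 24 <= D * (D * `|S|).
  have -> : k * M * (D * C) / 24 = D * (k * M * C / 24) by ring.
  by rewrite ler_pM2l.
have h3 : k * M * 2^-1 <= k * M * (D * C) by rewrite ler_wpM2l.
have -> : `|S| * (48 * D ^+ 2) = 48 * (D * (D * `|S|)) by ring.
by rewrite mulrC; lra.
Qed.

(** * Sine and cosine means of the geometric sum *)

Section lower_bound.
Context d (T : measurableType d) (R : realType) (P : probability T R).
Variables (X : nat -> {RV P >-> R}) (N : T -> nat) (p : R).
Hypothesis iidX : forall i (B : set R), measurable B -> P (X i @^-1` B) = P (X 0%N @^-1` B).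
Hypothesis iX0 : P.-integrable [set: T] (EFin \o X 0%N).
Hypothesis p01 : 0 < p < 1.
Hypothesis geoN : geometric_rv P N p.
Hypothesis indX : mutually_independent P
  (fun o : option nat => match o with
                         | None => fun w => (N w)%:R
                         | Some i => (X i : T -> R) end).

Let k := Num.sqrt p.
Let al := \int[P]_w cos (k * X 0%N w).
Let ga := \int[P]_w sin (k * X 0%N w).
Let s j := \int[P]_w sin (k * psum X j w).
Let c j := \int[P]_w cos (k * psum X j w).

Let iX i : P.-integrable [set: T] (EFin \o X i).
Proof. exact: (integrable_identical (@iidX i)). Qed.

Let msin : measurable_fun [set: R] (fun x : R => sin (k * x)).
Proof.
apply: measurableT_comp; last exact: measurable_funM.
by apply: continuous_measurable_fun; exact: continuous_sin.
Qed.

Let mcos : measurable_fun [set: R] (fun x : R => cos (k * x)).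
Proof.
apply: measurableT_comp; last exact: measurable_funM.
by apply: continuous_measurable_fun; exact: continuous_cos.
Qed.

Let isin (Z : T -> R) : measurable_fun [set: T] Z ->
  P.-integrable [set: T] (EFin \o (fun w => sin (k * Z w))).
Proof.
move=> mZ; apply: (@integrable_bounded _ _ _ _ _ 1) => [|w]; last exact: sin_max.
exact: (measurableT_comp msin).
Qed.

Let icos (Z : T -> R) : measurable_fun [set: T] Z ->
  P.-integrable [set: T] (EFin \o (fun w => cos (k * Z w))).
Proof.
move=> mZ; apply: (@integrable_bounded _ _ _ _ _ 1) => [|w]; last exact: cos_max.
exact: (measurableT_comp mcos).
Qed.

Let lsin : linear_growth (fun x : R => sin (k * x)).
Proof. by apply: (@bounded_linear_growth _ 1) => x; exact: sin_max. Qed.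

Let lcos : linear_growth (fun x : R => cos (k * x)).
Proof. by apply: (@bounded_linear_growth _ 1) => x; exact: cos_max. Qed.

Let alE j : \int[P]_v cos (k * X j v) = al.
Proof. by apply: (Rintegral_identical (@iidX j) mcos) => x; exact: cos_max. Qed.

Let gaE j : \int[P]_v sin (k * X j v) = ga.
Proof. by apply: (Rintegral_identical (@iidX j) msin) => x; exact: sin_max. Qed.

(** The addition formula, with the means over the last summand pulled out of the inner integral. *)
Let sS j : s j.+1 = al * s j + ga * c j.
Proof.
have [_ e] := Rintegral_psumS geoN.1 indX iX j msin lsin.
rewrite /s e -!RintegralZl//; last 2 first.
- exact: icos (measurable_psum X j).
- exact: isin (measurable_psum X j).
rewrite -RintegralD//; last 2 first.
- exact: (integrableZl measurableT _ (isin (measurable_psum X j))).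
- exact: (integrableZl measurableT _ (icos (measurable_psum X j))).
apply: eq_Rintegral => w _.
under eq_Rintegral do rewrite mulrDr sinD.
have iC := icos (measurable_funPT (X j)); have iS := isin (measurable_funPT (X j)).
rewrite RintegralD//; last 2 first.
- exact: (integrableZl measurableT _ iC).
- exact: (integrableZl measurableT _ iS).
by rewrite !RintegralZl// alE gaE; ring.
Qed.

Let cS j : c j.+1 = al * c j - ga * s j.
Proof.
have [_ e] := Rintegral_psumS geoN.1 indX iX j mcos lcos.
rewrite /c e -!RintegralZl//; last 2 first.
- exact: isin (measurable_psum X j).
- exact: icos (measurable_psum X j).
rewrite -RintegralB//; last 2 first.
- exact: (integrableZl measurableT _ (icos (measurable_psum X j))).
- exact: (integrableZl measurableT _ (isin (measurable_psum X j))).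
apply: eq_Rintegral => w _.
under eq_Rintegral do rewrite mulrDr cosD.
have iC := icos (measurable_funPT (X j)); have iS := isin (measurable_funPT (X j)).
rewrite RintegralB//; last 2 first.
- exact: (integrableZl measurableT _ iC).
- exact: (integrableZl measurableT _ iS).
by rewrite !RintegralZl// alE gaE; ring.
Qed.

Let S := \int[P]_w sin (k * rsum X N w).
Let C := \int[P]_w cos (k * rsum X N w).
Let Ts n := \sum_(j < n) p * (1 - p) ^+ j * s j.+1.
Let Tc n := \sum_(j < n) p * (1 - p) ^+ j * c j.+1.

Let cvgS : Ts n @[n --> \oo] --> S.
Proof.
apply: (cvg_geometric_mixture geoN.1 indX iX p01 geoN.2 msin lsin).
exact: (isin (measurable_rsum X geoN.1)).
Qed.

Let cvgC : Tc n @[n --> \oo] --> C.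
Proof.
apply: (cvg_geometric_mixture geoN.1 indX iX p01 geoN.2 mcos lcos).
exact: (icos (measurable_rsum X geoN.1)).
Qed.

Let s0 : s 0%N = 0.
Proof.
rewrite /s; under eq_Rintegral do rewrite /psum big_ord0 mulr0 sin0.
exact: Rintegral_prob_cst.
Qed.

Let c0 : c 0%N = 1.
Proof.
rewrite /c; under eq_Rintegral do rewrite /psum big_ord0 mulr0 cos0.
exact: Rintegral_prob_cst.
Qed.

Let TsS n : Ts n.+1 = p * ga + (1 - p) * (al * Ts n + ga * Tc n).
Proof.
rewrite /Ts big_ord_recl/= expr0 mulr1 sS s0 c0 mulr0 add0r mulr1; congr (_ + _).
rewrite /Tc !mulr_sumr -big_split/= mulr_sumr; apply: eq_bigr => j _.
by rewrite /bump/= add1n exprS sS; ring.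
Qed.

Let TcS n : Tc n.+1 = p * al + (1 - p) * (al * Tc n - ga * Ts n).
Proof.
rewrite /Tc big_ord_recl/= expr0 mulr1 cS s0 c0 mulr0 subr0 mulr1; congr (_ + _).
rewrite /Ts !mulr_sumr -sumrB mulr_sumr; apply: eq_bigr => j _.
by rewrite /bump/= add1n exprS cS; ring.
Qed.

(** First-step analysis: with probability p there is a single summand, otherwise a further geometric
    sum follows it. The recursion is exact for the truncated mixtures [Ts] and [Tc], and the fixed
    point is its limit. *)
Lemma sin_rsum_fixpoint : S = p * ga + (1 - p) * (al * S + ga * C).
Proof.
have h1 : Ts n.+1 @[n --> \oo] --> S by rewrite cvg_shiftS.
have h2 : Ts n.+1 @[n --> \oo] --> p * ga + (1 - p) * (al * S + ga * C).
  under eq_fun do rewrite TsS.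
  apply: cvgD; first exact: cvg_cst.
  apply: cvgM; first exact: cvg_cst.
  by apply: cvgD; apply: cvgM => //; exact: cvg_cst.
exact: (cvg_unique _ h1 h2).
Qed.

Lemma cos_rsum_fixpoint : C = p * al + (1 - p) * (al * C - ga * S).
Proof.
have h1 : Tc n.+1 @[n --> \oo] --> C by rewrite cvg_shiftS.
have h2 : Tc n.+1 @[n --> \oo] --> p * al + (1 - p) * (al * C - ga * S).
  under eq_fun do rewrite TcS.
  apply: cvgD; first exact: cvg_cst.
  apply: cvgM; first exact: cvg_cst.
  by apply: cvgB; apply: cvgM => //; exact: cvg_cst.
exact: (cvg_unique _ h1 h2).
Qed.

Hypothesis iXn : forall n, P.-integrable [set: T] (EFin \o (fun w => `|X 0%N w| ^+ n)).
Hypothesis EX0 : \int[P]_w X 0%N w = 0.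

Let m2 := \int[P]_w (X 0%N w ^+ 2).
Let m3 := \int[P]_w (X 0%N w ^+ 3).
Let a3 := \int[P]_w (`|X 0%N w| ^+ 3).
Let a5 := \int[P]_w (`|X 0%N w| ^+ 5).

Let p0 : 0 < p. Proof. by case/andP: p01. Qed.
Let k0 : 0 < k. Proof. by rewrite sqrtr_gt0. Qed.
Let kk : k ^+ 2 = p. Proof. by rewrite sqr_sqrtr// ltW. Qed.

Let iXpow n : P.-integrable [set: T] (EFin \o (fun w => X 0%N w ^+ n)).
Proof.
apply: (le_integrable _ _ _ (iXn n)) => //.
  by apply/measurable_EFinP; exact: measurable_funX.
by move=> w _ /=; rewrite lee_fin normrX normrX normr_id.
Qed.

Let ikX : P.-integrable [set: T] (EFin \o (fun w => k * X 0%N w)).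
Proof. exact: (integrableZl measurableT k iX0). Qed.

Let isX := isin (measurable_funPT (X 0%N)).
Let icX := icos (measurable_funPT (X 0%N)).

Let al_ge : 1 - 2^-1 * (p * m2) <= al.
Proof.
have i1 := integrableZl measurableT (2^-1 * p) (iXpow 2).
have iC := finite_measure_integrable_cst P 1 measurableT.
have -> : 1 - 2^-1 * (p * m2) = \int[P]_w (1 - 2^-1 * p * X 0%N w ^+ 2).
  by rewrite RintegralB// RintegralZl// ?Rintegral_prob_cst ?mulrA.
apply: le_Rintegral => //; first exact: (integrableB measurableT iC i1).
move=> w _; apply: le_trans (cos_ge_quadratic _).
have -> : 2^-1 * (k * X 0%N w) ^+ 2 = 2^-1 * p * X 0%N w ^+ 2 by rewrite exprMn kk mulrA.
exact: lexx.
Qed.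

Let al_le : al <= 1.
Proof.
rewrite -[leRHS](Rintegral_prob_cst P); apply: le_Rintegral => //.
exact: finite_measure_integrable_cst.
Qed.

Let ga_le : `|ga| <= 6^-1 * (p * k * a3).
Proof.
have iD := integrableB measurableT isX ikX.
have -> : ga = \int[P]_w (sin (k * X 0%N w) - k * X 0%N w).
  by rewrite RintegralB// RintegralZl// EX0 mulr0 subr0.
apply: (le_trans (le_normr_Rintegral _ iD)) => //.
have -> : 6^-1 * (p * k * a3) = \int[P]_w (6^-1 * (p * k) * `|X 0%N w| ^+ 3).
  by rewrite RintegralZl// mulrA.
apply: le_Rintegral => //.
- exact: integrable_abse iD.
- exact: (integrableZl measurableT _ (iXn 3)).
move=> w _; apply: (le_trans (sin_taylor1 _)).
have k3 : k ^+ 3 = p * k by rewrite exprS mulrC kk.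
by rewrite normrM (gtr0_norm k0) exprMn k3 mulrA lexx.
Qed.

(** The mean being 0, the cubic term leads: [ga] is close to - p k m3 / 6, and the fifth moment
    controls an error of order p^2 k. *)
Let ga_taylor : `|ga + 6^-1 * (p * k * m3)| <= 120^-1 * (p * k * (p * a5)).
Proof.
have iD := integrableB measurableT isX ikX.
have i3 := integrableZl measurableT (6^-1 * k ^+ 3) (iXpow 3).
have iE := integrableD measurableT iD i3.
have k3 : k ^+ 3 = p * k by rewrite exprS mulrC kk.
have -> : ga + 6^-1 * (p * k * m3) =
    \int[P]_w (sin (k * X 0%N w) - k * X 0%N w + 6^-1 * k ^+ 3 * X 0%N w ^+ 3).
  rewrite RintegralD// RintegralB// !RintegralZl//.
  by rewrite EX0 mulr0 subr0 k3 !mulrA.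
apply: (le_trans (le_normr_Rintegral _ iE)) => //.
have -> : 120^-1 * (p * k * (p * a5)) = \int[P]_w (120^-1 * k ^+ 5 * `|X 0%N w| ^+ 5).
  rewrite RintegralZl//.
  by rewrite (_ : k ^+ 5 = p * k * p) ?mulrA// -kk; ring.
apply: le_Rintegral => //.
- exact: integrable_abse iE.
- exact: (integrableZl measurableT _ (iXn 5)).
move=> w _; have := sin_taylor3 (k * X 0%N w).
by rewrite normrM (gtr0_norm k0) !exprMn !mulrA.
Qed.

(** The smallness conditions give in turn 1 - p >= 1/2, al >= 3/4, |ga| <= p / 6 and, because 1/6 -
    1/120 > 1/12, the lower bound p k |m3| / 12 for |ga|. *)
Lemma sin_rsum_lower_bound :
  p <= 2^-1 -> p * (m2 + 1) <= 2^-1 -> k * (a3 + 1) <= 1 -> p * (a5 + 1) <= `|m3| ->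
  `|m3| / (48 * (1 + m2 / 2) ^+ 2) * k <= `|S|.
Proof.
move=> p2 pm2 ka3 pa5.
have m20 : 0 <= m2 by apply: Rintegral_ge0 => w _; exact: sqr_ge0.
have a30 : 0 <= a3 by apply: Rintegral_ge0 => w _; exact: exprn_ge0.
have a50 : 0 <= a5 by apply: Rintegral_ge0 => w _; exact: exprn_ge0.
have S1 : `|S| <= 1.
  have iS : P.-integrable [set: T] (EFin \o (fun w => sin (k * rsum X N w))).
    exact: (isin (measurable_rsum X geoN.1)).
  apply: (le_trans (le_normr_Rintegral _ iS)) => //.
  rewrite -[leRHS](Rintegral_prob_cst P); apply: le_Rintegral => //.
  - exact: integrable_abse iS.
  - exact: finite_measure_integrable_cst.
  - by move=> w _; exact: sin_max.
have pk0 : 0 < p * k by exact: mulr_gt0.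
have ga_le' : `|ga| <= 6^-1 * p.
  apply: (le_trans ga_le); rewrite -mulrA ler_pM2l ?invr_gt0// ler_piMr ?(ltW p0)//; nra.
have ga_ge : 12^-1 * (p * k * `|m3|) <= `|ga|.
  have t1 : 6^-1 * (p * k * `|m3|) <= `|ga| + 120^-1 * (p * k * (p * a5)).
    have -> : 6^-1 * (p * k * `|m3|) = `|6^-1 * (p * k * m3)|.
      by rewrite 2!normrM (gtr0_norm pk0) (ger0_norm (_ : 0 <= 6^-1)).
    have -> : 6^-1 * (p * k * m3) = (ga + 6^-1 * (p * k * m3)) - ga by ring.
    rewrite (le_trans (ler_normB _ _))// addrC lerD2l.
    exact: ga_taylor.
  have t2 : p * k * (p * a5) <= p * k * `|m3|.
    by rewrite ler_pM2l// (le_trans _ pa5)// ler_pM2l// lerDl.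
  have t3 : 0 <= p * k * `|m3| by rewrite mulr_ge0// ltW.
  by move: t1 t2 t3; move: (p * k * (p * a5)) (p * k * `|m3|) `|ga| => x y z; lra.
exact: (fixpoint_lower_bound S1 ga_le' ga_ge p2 pm2 m20 p0 k0 (normr_ge0 m3)
  al_le al_ge cos_rsum_fixpoint sin_rsum_fixpoint).
Qed.

End lower_bound.

Lemma dW_laplace_ge d (T : measurableType d) (R : realType) (P : probability T R)
    (X : nat -> {RV P >-> R}) (b : R) : 0 < b ->
  (forall i (B : set R), measurable B -> P (X i @^-1` B) = P (X 0%N @^-1` B)) ->
  'E_P[X 0%N] = 0%E ->
  (forall n : nat, P.-integrable setT (fun w => (`|X 0%N w| ^+ n)%:E)) ->
  'E_P[fun w => (X 0%N w ^+ 3)%R] != 0%E ->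
  exists c : R, 0 < c /\ exists p0 : R, 0 < p0 /\
    forall (p : R) (N : T -> nat), 0 < p -> p < p0 -> p < 1 ->
      geometric_rv P N p ->
      mutually_independent P
        (fun o : option nat => match o with
                               | None => fun w => (N w)%:R
                               | Some i => (X i : T -> R) end) ->
      ((c * Num.sqrt p)%:E <=
         dW_laplace P (random_sum (fun i => (X i : T -> R)) N p) b)%E.
Proof.
move=> b0 iidX EX0 iXn EX3.
have iX0 : P.-integrable [set: T] (EFin \o X 0%N).
  apply: (le_integrable _ _ _ (iXn 1%N)) => //; first exact/measurable_EFinP.
  by move=> w _ /=; rewrite lee_fin expr1 normr_id.
have RX0 : \int[P]_w X 0%N w = 0 by rewrite /Rintegral; move: EX0; rewrite unlock => ->.
pose m2 := \int[P]_w (X 0%N w ^+ 2).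
pose m3 := \int[P]_w (X 0%N w ^+ 3).
pose a3 := \int[P]_w (`|X 0%N w| ^+ 3).
pose a5 := \int[P]_w (`|X 0%N w| ^+ 5).
have m20 : 0 <= m2 by apply: Rintegral_ge0 => w _; exact: sqr_ge0.
have a30 : 0 <= a3 by apply: Rintegral_ge0 => w _; exact: exprn_ge0.
have a50 : 0 <= a5 by apply: Rintegral_ge0 => w _; exact: exprn_ge0.
have m30 : 0 < `|m3|.
  have iX3 : P.-integrable [set: T] (EFin \o (fun w => X 0%N w ^+ 3)).
    apply: (le_integrable _ _ _ (iXn 3)) => //.
      by apply/measurable_EFinP; exact: measurable_funX.
    by move=> w _ /=; rewrite lee_fin normrX normrX normr_id.
  rewrite normr_gt0; apply: contra_neq EX3 => m30.
  by rewrite unlock -[LHS]fineK; [congr EFin|exact: (integrable_fin_num _ iX3)].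
exists (`|m3| / (48 * (1 + m2 / 2) ^+ 2)); split.
  by rewrite divr_gt0// mulr_gt0// exprn_gt0//; lra.
(* One threshold for each condition of [sin_rsum_lower_bound]; the one on sqrt p becomes p <= (a3 +
   1)^-2. The added 1 keeps the denominators positive. Only moments of [X 0%N] enter, so the
   threshold is fixed before [p] and [N]. *)
exists (Num.min (Num.min 2^-1 (2 * (m2 + 1))^-1) (Num.min ((a3 + 1)^-1 ^+ 2) (`|m3| / (a5 + 1)))).
have m21 : 0 < m2 + 1 by lra.
have a31 : 0 < a3 + 1 by lra.
have a51 : 0 < a5 + 1 by lra.
split.
  by rewrite !lt_min invr_gt0 ltr0n invr_gt0 mulr_gt0// exprn_gt0 ?invr_gt0// divr_gt0.
move=> p N p0 + p1 geoN indX.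
rewrite !lt_min => /andP[/andP[/ltW pa /ltW pb] /andP[/ltW pc /ltW pd]].
have p01 : 0 < p < 1 by rewrite p0.
apply: (@le_trans _ _ (`|\int[P]_w sin (Num.sqrt p * rsum X N w)|)%:E).
  rewrite lee_fin; apply: (sin_rsum_lower_bound iidX iX0 p01 geoN indX iXn RX0) => //.
  - by move: pb; rewrite invfM ler_pdivlMr.
  - rewrite -ler_pdivlMr// mul1r -[leRHS]ger0_norm ?invr_ge0 ?(ltW a31)// -sqrtr_sqr.
    by rewrite ler_sqrt// exprn_ge0// invr_ge0 ltW.
  - by rewrite -ler_pdivlMr.
apply: ereal_sup_ubound; exists sin.
  by move=> x y; have := sin_lipschitz x y; rewrite mul1r.
rewrite (laplace_expect_stein_sol b0 ler01 (@sin_lipschitz R)) stein_sol_sin// sube0.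
have iS : P.-integrable [set: T] (EFin \o (fun w => sin (Num.sqrt p * rsum X N w))).
  apply: (@integrable_bounded _ _ _ _ _ 1) => [|w]; last exact: sin_max.
  apply: measurableT_comp.
    by apply: continuous_measurable_fun; exact: continuous_sin.
  by apply: measurable_funM => //; exact: (measurable_rsum X geoN.1).
by rewrite unlock -EFin_normr_Rintegral.
Qed.

Unset Implicit Arguments.

Theorem theorem5p10 (R : realType) (d : measure_display) (T : measurableType d)
    (P : probability T R) :
  (* Kolmogorov and Wasserstein upper bounds *)
  (forall (X : nat -> {RV P >-> R}) (sigma p : R) (N : T -> nat)
      (L : nat -> probability R R),
    0 < sigma -> 0 < p < 1 ->
    (forall i, 'E_P[X i] = 0%E) ->
    (forall i, 'E_P[fun w => (X i w ^+ 2)%R] = (sigma ^+ 2)%:E) ->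
    geometric_rv P N p ->
    mutually_independent P
      (fun o : option nat => match o with
                             | None => fun w => (N w)%:R
                             | Some i => (X i : T -> R) end) ->
    (forall i, equilibrium_law P (X i) (L i)) ->
    let W := random_sum (fun i => (X i : T -> R)) N p in
    let b := sigma / Num.sqrt 2 in
    let rho := ereal_sup (range (fun i => 'E_P[fun w => (`|X i w| ^+ 3)%R])) in
    (dK_laplace P W b <=
       (1704 / 100 * Num.sqrt p / sigma)%:E *
       ereal_sup [set e | exists (i : nat) (u : R), (0 < u < 1)%R /\
         e = (`|gen_inv (cdf_rv P (X i)) u - gen_inv (cdf_law (L i)) u|)%:E])%E /\
    ((rho < +oo)%E ->
     (dW_laplace P W b <=
        (12 * Num.sqrt p)%:E * (sigma%:E + rho * ((3 * sigma ^+ 2)^-1)%:E))%E)) /\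
  (* optimality of the order p^{1/2} *)
  (forall (X : nat -> {RV P >-> R}) (sigma : R),
    0 < sigma ->
    mutually_independent P (fun i => (X i : T -> R)) ->
    (forall i (B : set R), measurable B -> P (X i @^-1` B) = P (X 0%N @^-1` B)) ->
    'E_P[X 0%N] = 0%E ->
    'E_P[fun w => (X 0%N w ^+ 2)%R] = (sigma ^+ 2)%:E ->
    (forall n : nat, P.-integrable setT (fun w => (`|X 0%N w| ^+ n)%:E)) ->
    'E_P[fun w => (X 0%N w ^+ 3)%R] != 0%E ->
    exists c : R, 0 < c /\ exists p0 : R, 0 < p0 /\
      forall (p : R) (N : T -> nat), 0 < p -> p < p0 -> p < 1 ->
        geometric_rv P N p ->
        mutually_independent P
          (fun o : option nat => match o with
                                 | None => fun w => (N w)%:R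
                                 | Some i => (X i : T -> R) end) ->
        ((c * Num.sqrt p)%:E <=
           dW_laplace P (random_sum (fun i => (X i : T -> R)) N p)
             (sigma / Num.sqrt 2))%E).
Proof.
split.
- move=> X sigma p N L sigma0 p01 EX0 EX2 geoN indX eqL W b rho; split.
    exact: dK_laplace_le.
  exact: dW_laplace_le.
- move=> X sigma sigma0 _ iidX EX0 _ iXn EX3.
  by apply: dW_laplace_ge => //; rewrite divr_gt0// sqrtr_gt0.
Qed.
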